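(* Let $\lambda\vdash n$, let $S^\lambda$ be the Specht module with basis $\mathcal{B}=\{e_T: T\in\mathrm{SYT}(\lambda)\}$, totally ordered by $e_S\vartriangleleft e_T$ iff $S\vartriangleleft T$. Then $(S^\lambda,\mathcal{B},\vartriangleleft)$ is strongly quasisymmetric characteristic compatible.
   Context: Tableaux in French notation (bottom row longest; north/south = higher/lower row, west/east = left/right). $\mathrm{SYT}(\lambda)$: standard Young tableaux (entries $1,\dots,n$ increasing along rows and up columns). $e_T=\sum_\sigma\mathrm{sgn}(\sigma)\{\sigma T\}$ over column-preserving permutations, $\{\cdot\}$ being tabloids; $\mathfrak{S}_n$ acts on $S^\lambda$ by permuting letters. For standard $S,T$ of the same shape, $S\vartriangleleft T$ means the smallest letter occupying different positions in $S$ and $T$ lies further to the (weakly) northwest in $T$ than in $S$; this is a total order on $\mathrm{SYT}(\lambda)$. SQCC: let $M$ be a finite-dimensional $\mathfrak{S}_n$-module with basis $\mathcal{B}=\{v_1,\dots,v_k\}$ totally ordered $v_1\le\cdots\le v_k$; for $w=\sum c_jv_j\neq0$, $\mathrm{tt}(w)=c_jv_j$ for the $\le$-smallest $v_j$ with $c_j\ne0$. Define $\overline{\pi}_i$ on $\mathcal{B}$ (extended linearly): $\overline{\pi}_i(v_t)=0$ if $\mathrm{tt}(s_iv_t)=v_t$; $-v_t$ if $s_iv_t=v_j>v_t$ for some basis $v_j$ or $s_iv_t=-v_t$; $s_iv_t$ if $s_iv_t=v_j<v_t$ for some basis $v_j$ — assuming every basis element falls in one of these cases. If these satisfy the 0-Hecke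 relations $\overline{\pi}_i^2=-\overline{\pi}_i$, $\overline{\pi}_i\overline{\pi}_j=\overline{\pi}_j\overline{\pi}_i$ ($|i-j|\ge2$), $\overline{\pi}_i\overline{\pi}_{i+1}\overline{\pi}_i=\overline{\pi}_{i+1}\overline{\pi}_i\overline{\pi}_{i+1}$, call the resulting $\mathcal{H}_n(0)$-module $\widehat M$; $(M,\mathcal{B},\le)$ is SQCC if this holds and $F^Q_{char}(\widehat M)=F_{char}(M)$. Here $C_I$ ($I\subseteq[n-1]$) is the one-dimensional $\mathcal{H}_n(0)$-module with $\overline{\pi}_i$ acting by $-1$ for $i\in I$ and $0$ otherwise; $F^Q_{char}(N)=\sum_jF_{I_j}$ for composition factors $C_{I_1},\dots,C_{I_m}$ of $N$, with $F_I=\sum x_{i_1}\cdots x_{i_n}$ over $1\le i_1\le\cdots\le i_n$, $i_j<i_{j+1}$ for $j\in I$; $F_{char}$ sends Specht modules $S^\mu$ to Schur functions $s_\mu$. *)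

(* Defs.v *)
From mathcomp Require Import all_boot all_order all_algebra all_fingroup.
From mathcomp Require Import all_character.
From mathcomp Require Import mpoly.

Set Implicit Arguments.
Unset Strict Implicit.
Unset Printing Implicit Defensive.

Import GroupScope GRing.Theory.
Local Open Scope ring_scope.

(* Letters 1, ..., n are encoded as 0, ..., n-1 : 'I_n, and the index set
   [n-1] = {1, ..., n-1} as 'I_n.-1, so that i : 'I_n.-1 stands for the pair of
   consecutive letters (lo i, hi i). *)
Section Letters.

Variable n : nat.

Definition lo (i : 'I_n.-1) : 'I_n := widen_ord (leq_pred n) i.

Lemma hi_subproof (i : 'I_n.-1) : (i.+1 < n)%N.
Proof. by rewrite -ltn_predRL. Qed.

Definition hi (i : 'I_n.-1) : 'I_n := Ordinal (hi_subproof i).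

Definition adj (i : 'I_n.-1) : 'S_n := tperm (lo i) (hi i).

End Letters.

(* Elements of bounded degree of Z[[x_1, x_2, ...]], given by all their
   truncations x_{N+1} = x_{N+2} = ... = 0 (an element is determined by the
   family of its truncations). *)
Definition fseries := forall N : nat, {mpoly int[N]}.

(* The sum of x_{t_1} ... x_{t_n} over t_1 <= ... <= t_n with t_j < t_(j+1)
   for j in I. *)
Definition fundamental n (I : {set 'I_n.-1}) : fseries := fun N =>
  \sum_(t : {ffun 'I_n -> 'I_N} |
        [forall i : 'I_n.-1,
           (t (lo i) <= t (hi i))%N && ((i \in I) ==> (t (lo i) < t (hi i))%N)])
    \prod_(j < n) 'X_(t j).

Definition is_intpart n (mu : seq nat) : bool :=
  [&& sorted geq mu, 0%N \notin mu & sumn mu == n].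

Record intpart n := IntPart {
  parts :> seq nat;
  intpartP : is_intpart n parts
}.

(* French notation: row 0 is the bottom (longest) row and column 0 the westmost
   one; north is larger row, west is smaller column. *)
Definition box (mu : seq nat) :=
  {p : 'I_(size mu) * 'I_(head 0%N mu) | (p.2 < nth 0%N mu p.1)%N}.

Definition box_row mu (b : box mu) : nat := (sval b).1.
Definition box_col mu (b : box mu) : nat := (sval b).2.

Definition schur (mu : seq nat) : fseries := fun N =>
  \sum_(t : {ffun box mu -> 'I_N} |
        [forall b, forall b',
           ((box_row b == box_row b') && (box_col b < box_col b')%N ==> (t b <= t b')%N)
           && ((box_col b == box_col b') && (box_row b < box_row b')%N ==> (t b < t b')%N)])
    \prod_(b : box mu) 'X_(t b).

Section Tableaux.

Variables (n : nat) (mu : seq nat).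

Definition is_tableau (t : {ffun box mu -> 'I_n}) : bool :=
  injectiveb t && [forall x, x \in codom t].

Definition tableau := {t : {ffun box mu -> 'I_n} | is_tableau t}.

Lemma pos_subproof (T : tableau) x : x \in codom (sval T).
Proof. by case: T => t /= /andP[_ /forallP]. Qed.

Definition pos (T : tableau) (x : 'I_n) : box mu := iinv (pos_subproof T x).

Definition is_standard (T : tableau) : bool :=
  [forall b, forall b',
     ((box_row b == box_row b') && (box_col b < box_col b')%N ==> (sval T b < sval T b')%N)
     && ((box_col b == box_col b') && (box_row b < box_row b')%N ==>
           (sval T b < sval T b')%N)].

Definition SYT := {T : tableau | is_standard T}.

Definition syt_lt (S T : SYT) : bool :=
  [exists x : 'I_n,
     [&& pos (sval S) x != pos (sval T) x,
         [forall y : 'I_n,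
            (y < x)%N ==> (pos (sval S) y == pos (sval T) y)],
         (box_row (pos (sval S) x) <= box_row (pos (sval T) x))%N
       & (box_col (pos (sval T) x) <= box_col (pos (sval S) x))%N]].

Definition syt_le (S T : SYT) : bool := (S == T) || syt_lt S T.

Lemma posK (T : tableau) x : sval T (pos T x) = x.
Proof. exact: f_iinv. Qed.

Lemma Kpos (T : tableau) b : pos T (sval T b) = b.
Proof.
by case/andP: (svalP T) => /injectiveP Tinj _; apply: Tinj; rewrite posK.
Qed.

Lemma tact_subproof (s : 'S_n) (T : tableau) :
  is_tableau [ffun b => s (sval T b)].
Proof.
apply/andP; split.
  apply/injectiveP => b b'; rewrite !ffunE => /perm_inj /(congr1 (pos T)).
  by rewrite !Kpos.
apply/forallP => x; apply/codomP; exists (pos T (s^-1%g x)).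
by rewrite ffunE posK permKV.
Qed.

Definition tact (s : 'S_n) (T : tableau) : tableau :=
  exist (fun t => is_true (is_tableau t)) _ (tact_subproof s T).

Lemma pos_tact s T x : pos (tact s T) (s x) = pos T x.
Proof. by rewrite -{1}(posK T x) -[s _](ffunE (fun b => s (sval T b))) Kpos. Qed.

Lemma pos_tactV s T x : pos (tact s T) x = pos T (s^-1%g x).
Proof. by rewrite -{1}(permKV s x) pos_tact. Qed.

Lemma tactM s u T : tact (s * u)%g T = tact u (tact s T).
Proof. by apply: val_inj; apply/ffunP => b; rewrite /= !ffunE permM. Qed.

Lemma tact1 T : tact 1%g T = T.
Proof. by apply: val_inj; apply/ffunP => b; rewrite /= !ffunE perm1. Qed.

Definition row_class (T : tableau) : {set tableau} :=
  [set T' | [forall x, box_row (pos T' x) == box_row (pos T x)]].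

Definition tabloid := {X : {set tableau} | X \in codom row_class}.

Definition tabloid_of (T : tableau) : tabloid :=
  exist (fun X => is_true (X \in codom row_class)) (row_class T)
    (codom_f row_class T).

Lemma row_class_tact s T : [set tact s T' | T' in row_class T] =
  row_class (tact s T).
Proof.
apply/setP => T'; apply/imsetP/idP => [[T1 + ->]|]; rewrite !inE.
  move=> /forallP eqr; apply/forallP => x.
  by rewrite !pos_tactV.
move=> /forallP eqr; exists (tact s^-1%g T'); last first.
  by rewrite -tactM mulVg tact1.
rewrite inE; apply/forallP => x.
by have := eqr (s x); rewrite pos_tact pos_tactV invgK.
Qed.

Definition col_stab (T : tableau) (s : 'S_n) : bool :=
  [forall x, box_col (pos T (s x)) == box_col (pos T x)].

Lemma col_stabJ T s u : col_stab (tact s T) (u ^ s)%g = col_stab T u.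
Proof.
apply/forallP/forallP => H x; first by have := H (s x); rewrite permJ !pos_tact.
by rewrite -(permKV s x) permJ !pos_tact.
Qed.

End Tableaux.

Section Specht.

Variables (F : fieldType) (n : nat) (mu : seq nat).

Local Notation tabloid := (tabloid n mu).
Local Notation tableau := (tableau n mu).

Definition tabloid_vec (X : tabloid) : 'rV[F]_#|{: tabloid}| :=
  delta_mx 0 (enum_rank X).

(* 'S_n acts on row vectors on the right.  As (s * t)%g applies s first, this
   is the usual left action: s . w is w *m tabloid_mx s, and s . {T} = {s T}. *)
Definition tabloid_mx (s : 'S_n) : 'M[F]_#|{: tabloid}| :=
  \matrix_(i, j)
    (sval (enum_val j : tabloid)
       == [set tact s T | T in sval (enum_val i : tabloid)])%:R.

Lemma tabloid_vecJ s T :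
  tabloid_vec (tabloid_of T) *m tabloid_mx s
  = tabloid_vec (tabloid_of (tact s T)).
Proof.
rewrite -rowE; apply/rowP => j; rewrite !mxE eqxx /= enum_rankK /=.
rewrite row_class_tact; congr (_%:R); congr (nat_of_bool _).
by rewrite -(can2_eq enum_valK enum_rankK) -val_eqE.
Qed.

Lemma tabloid_mx_repr : mx_repr [set: 'S_n] tabloid_mx.
Proof.
have tabP (X : tabloid) : exists T, X = tabloid_of T.
  by case: X => X XP; case/codomP: (XP) => T eqX; exists T; apply: val_inj.
split=> [|s u _ _]; apply/row_matrixP => i;
  have [T defX] := tabP (enum_val i);
  have di : delta_mx 0 i = tabloid_vec (tabloid_of T)
    by rewrite /tabloid_vec -defX enum_valK.
- by rewrite !rowE di tabloid_vecJ tact1 mulmx1.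
- by rewrite !rowE di mulmxA !tabloid_vecJ tactM.
Qed.

Definition tabloid_repr : mx_representation F [set: 'S_n] #|{: tabloid}| :=
  MxRepresentation tabloid_mx_repr.

Definition polytabloid (T : tableau) : 'rV[F]_#|{: tabloid}| :=
  \sum_(s : 'S_n | col_stab T s) (-1) ^+ s *: tabloid_vec (tabloid_of (tact s T)).

Lemma polytabloidJ s T :
  polytabloid T *m tabloid_mx s = polytabloid (tact s T).
Proof.
rewrite /polytabloid mulmx_suml (reindex_inj (conjg_inj s^-1%g)) /=.
apply: eq_big => u; first by rewrite -(col_stabJ T s) conjgKV.
move=> _; rewrite -scalemxAl tabloid_vecJ odd_permJ -!tactM.
by rewrite conjgE invgK mulgA mulgKV.
Qed.

Definition specht_space : 'M[F]_#|{: tabloid}| :=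
  (\sum_(T : tableau) <<polytabloid T>>)%MS.

Lemma specht_module : mxmodule tabloid_repr specht_space.
Proof.
apply/mxmoduleP => s _; rewrite sumsmxMr; apply/sumsmx_subP => T _.
rewrite (eqmxMr _ (genmxE _)) polytabloidJ.
by rewrite (sumsmx_sup (tact s T)) // genmxE.
Qed.

Definition specht : representation F [set: 'S_n] :=
  Representation (submod_repr specht_module).

Definition standard_polytabloid (T : SYT n mu) : 'rV[F]_(rdegree specht) :=
  in_submod specht_space (polytabloid (sval T)).

End Specht.

Section HeckeZero.

Variables (F : fieldType) (n m : nat) (pi : 'I_n.-1 -> 'M[F]_m).

(* Generators act on row vectors on the right; the relations are invariant
   under reversal of products. *)
Definition hecke0_rels : Prop :=
  [/\ forall i, pi i *m pi i = - pi i,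
      forall i j : 'I_n.-1, (i + 2 <= j)%N || (j + 2 <= i)%N ->
        pi i *m pi j = pi j *m pi i
    & forall i j : 'I_n.-1, j = i.+1 :> nat ->
        pi i *m pi j *m pi i = pi j *m pi i *m pi j].

(* The scalar by which the i-th generator acts on C_I. *)
Definition simple_scalar (I : {set 'I_n.-1}) (i : 'I_n.-1) : F :=
  if i \in I then -1 else 0.

(* A composition series 0 = U_0 < U_1 < ... < U_k = F^m (row spaces) with
   U_(j+1) / U_j isomorphic to C_{I_j}, Is being the list of the I_j. *)
Definition composition_factors (Is : seq {set 'I_n.-1}) : Prop :=
  exists U : nat -> 'M[F]_m,
    [/\ U 0%N = 0, (U (size Is) :=: 1%:M)%MS,
        forall j i, (j <= size Is)%N -> stablemx (U j) (pi i)
      & forall j, (j < size Is)%N ->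
          [/\ (U j <= U j.+1)%MS, \rank (U j.+1) = (\rank (U j)).+1
            & forall i (u : 'rV[F]_m), (u <= U j.+1)%MS ->
                (u *m pi i - simple_scalar (nth set0 Is j) i *: u <= U j)%MS]].

(* Single-valued by the Jordan-Hoelder theorem. *)
Definition is_FQchar (f : fseries) : Prop :=
  exists Is : seq {set 'I_n.-1},
    composition_factors Is
    /\ forall N, f N = \sum_(I <- Is) fundamental I N.

End HeckeZero.

(* Single-valued in characteristic 0, where the S^mu are simple and pairwise
   non-isomorphic. *)
Definition is_Fchar (F : fieldType) n m
    (rG : mx_representation F [set: 'S_n] m) (f : fseries) : Prop :=
  exists mus : seq (intpart n),
    mx_rsim rG (\big[dadd_grepr/grepr0]_(mu <- mus) specht F n mu)
    /\ forall N, f N = \sum_(mu <- mus) schur mu N.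

Section SQCC.

Variables (F : fieldType) (n m : nat) (rG : mx_representation F [set: 'S_n] m).
Variables (K : finType) (v : K -> 'rV[F]_m) (le : rel K).

Definition coord_at (w : 'rV[F]_m) (t : K) : F :=
  coord (codom_tuple v) (enum_rank t) w.

Definition strict (t u : K) : bool := (t != u) && le t u.

(* tt(w), with the convention tt(0) = 0. *)
Definition trailing_term (w : 'rV[F]_m) : 'rV[F]_m :=
  if [pick t | (coord_at w t != 0) && [forall u, (coord_at w u != 0) ==> le t u]]
    is Some t then coord_at w t *: v t else 0.

Definition sact (i : 'I_n.-1) (w : 'rV[F]_m) : 'rV[F]_m := w *m rG (adj i).

Definition case_zero i t : bool := trailing_term (sact i (v t)) == v t.

Definition case_opp i t : bool :=
  [exists u, strict t u && (sact i (v t) == v u)] || (sact i (v t) == - v t).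

Definition case_swap i t : bool :=
  [exists u, strict u t && (sact i (v t) == v u)].

(* The three cases are mutually exclusive in characteristic other than 2. *)
Definition pibar_basis i t : 'rV[F]_m :=
  if case_zero i t then 0
  else if case_opp i t then - v t
  else sact i (v t).

Definition pibar (i : 'I_n.-1) : 'M[F]_m :=
  lin1_mx (fun w => \sum_t coord_at w t *: pibar_basis i t).

Definition SQCC : Prop :=
  [/\ basis_of fullv (codom v),
      [/\ reflexive le, antisymmetric le, transitive le & total le],
      forall i t, [|| case_zero i t, case_opp i t | case_swap i t],
      hecke0_rels pibar
    & exists f : fseries, is_Fchar rG f /\ is_FQchar pibar f].

End SQCC.

(* Main.v *)
Require Import Defs.
From mathcomp Require Import all_boot all_order all_algebra all_fingroup.
From mathcomp Require Import all_character.
From mathcomp Require Import mpoly zify.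

(* Encode a tableau by its row word (row of 1, row of 2, ...), compared
   lexicographically; on standard tableaux this is the given order, because the
   two cells of the first letter in different positions lie strictly northwest
   and southeast of each other.  Permuting the columns of a column-increasing T
   first moves a letter north, so {T} is the least tabloid of e_T; hence the
   standard e_T are independent.  They span by the Garnir relations, which in
   characteristic 0 may be averaged over the symmetric group of the Garnir set.
   If i and i+1 share a row of T, then {T} is still the least tabloid of
   s_i e_T, so tt(s_i e_T) = e_T.  Thus pibar_i acts on e_T by 0, by -1 or by
   exchanging i and i+1 according to how the letters i and i+1 of the row word
   compare, and the 0-Hecke relations are checked on words.  As pibar_i e_T is a
   multiple of e_T or a smaller basis element, the initial segments of the basis
   span a composition series whose factors are indexed by descent sets, and
   standardization of semistandard tableaux shows that the corresponding
   fundamental quasisymmetric functions add up to s_lambda. *)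

Set Implicit Arguments.
Unset Strict Implicit.
Unset Printing Implicit Defensive.

Import GroupScope GRing.Theory.
Local Open Scope ring_scope.

(** * Row words and the order on standard tableaux *)

Local Notation rowof T x := (box_row (pos T x)).
Local Notation colof T x := (box_col (pos T x)).

Section Boxes.

Variable mu : seq nat.

Lemma box_eq (b b' : box mu) :
  box_row b = box_row b' -> box_col b = box_col b' -> b = b'.
Proof.
case: b b' => [[r c] p] [[r' c'] p'].
rewrite /box_row /box_col /= => /val_inj e1 /val_inj e2.
by apply: val_inj; rewrite /= e1 e2.
Qed.

Lemma nth_sorted_geq i j : sorted geq mu -> (i <= j)%N ->
  (nth 0 mu j <= nth 0 mu i)%N.
Proof.
move=> mu_sorted leij; have [ltj|/(nth_default 0%N)-> //] := ltnP j (size mu).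
apply: (sorted_leq_nth (leT := geq)) => //.
- by move=> y x z /= xy yz; apply: leq_trans yz xy.
- by move=> x /=.
- by rewrite inE (leq_ltn_trans leij).
Qed.

(** Rows further south are at least as long, so the row of [b] reaches the column of [b']. *)
Lemma box_corner (b b' : box mu) : sorted geq mu ->
  (box_row b <= box_row b')%N ->
  exists2 d : box mu, box_row d = box_row b & box_col d = box_col b'.
Proof.
case: b b' => [[r c] p] [[r' c'] p']; rewrite /box_row /box_col /= => smu lerr.
have q : (c' < nth 0 mu r)%N by apply: leq_trans p' (nth_sorted_geq smu lerr).
by exists (exist _ (r, c') q).
Qed.

Lemma card_box n : is_intpart n mu -> #|{: box mu}| = n.
Proof.
case/and3P => smu _ /eqP <-; rewrite card_sig.
transitivity (\sum_(i < size mu) nth 0%N mu i)%N; last first.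
  by rewrite sumnE (big_nth 0%N) big_mkord.
rewrite -sum1_card.
rewrite (eq_bigl (fun p : 'I_(size mu) * 'I_(head 0 mu) =>
  xpredT p.1 && (p.2 < nth 0 mu p.1)%N)) //.
rewrite -(pair_big_dep xpredT
  (fun (i : 'I_(size mu)) (c : 'I_(head 0 mu)) => (c < nth 0 mu i)%N)
  (fun _ _ => 1%N)).
apply: eq_bigr => i _ /=; rewrite sum1_card.
have le_head : (nth 0 mu i <= head 0 mu)%N.
  by rewrite -nth0; apply: nth_sorted_geq.
rewrite -[RHS]card_ord -(card_imset _ (f := widen_ord le_head)).
  apply: eq_card => c; apply/idP/imsetP => [ltc|[d _ ->]].
    by exists (Ordinal ltc) => //; apply: val_inj.
  by case: d => d /=.
by move=> x y /(congr1 val) /= /val_inj.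
Qed.

End Boxes.

(** * Lexicographic comparison of words *)

Section Lexicographic.

Variable n : nat.
Implicit Types f g h : 'I_n -> nat.

Definition lexlt f g : bool :=
  [exists x : 'I_n,
     [forall y : 'I_n, (y < x)%N ==> (f y == g y)] && (f x < g x)%N].

Lemma lexltP f g :
  reflect (exists2 x : 'I_n, (forall y : 'I_n, (y < x)%N -> f y = g y)
                             & (f x < g x)%N)
    (lexlt f g).
Proof.
apply: (iffP existsP) => [[x /andP[/forallP eqfg ltfg]]|[x eqfg ltfg]]; exists x => //.
  by move=> y ltyx; apply/eqP/(implyP (eqfg y)).
by rewrite ltfg andbT; apply/forallP => y; apply/implyP => /eqfg ->.
Qed.

Lemma first_diff f g : ~ f =1 g ->
  exists2 x : 'I_n, (forall y : 'I_n, (y < x)%N -> f y = g y) & f x <> g x.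
Proof.
move=> neqfg; have [/existsP[x0 neqx0]|/existsPn eqfg] :=
    boolP [exists x, f x != g x]; last first.
  by case: neqfg => x; have := eqfg x; rewrite negbK => /eqP.
case: (@arg_minnP _ x0 (fun x => f x != g x) (fun x : 'I_n => x : nat) neqx0) =>
  x neqx minx.
exists x; last exact/eqP.
move=> y ltyx; apply/eqP; apply: contraTT ltyx => /minx; by rewrite -leqNgt.
Qed.

Lemma lexlt_total f g : [\/ f =1 g, lexlt f g | lexlt g f].
Proof.
have [/forallP eqfg|neqfg] := boolP [forall x, f x == g x].
  by constructor 1 => x; apply/eqP.
have [|x eqx neqx] := @first_diff f g.
  by move=> eqfg; case/forallP: neqfg => x; apply/eqP.
case: (ltngtP (f x) (g x)) => // [ltx|gtx]; [constructor 2|constructor 3].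
  by apply/lexltP; exists x.
by apply/lexltP; exists x => // y /eqx.
Qed.

Lemma lexlt_irr f : lexlt f f = false.
Proof. by apply/lexltP => -[x _]; rewrite ltnn. Qed.

Lemma lexlt_trans f g h : lexlt f g -> lexlt g h -> lexlt f h.
Proof.
move=> /lexltP[x eqx ltx] /lexltP[y eqy lty]; apply/lexltP.
case: (ltngtP x y) => [ltxy|ltyx|/val_inj eqxy].
- exists x => [z ltzx|]; last by rewrite -eqy.
  by rewrite eqx // eqy // (ltn_trans ltzx).
- exists y => [z ltzy|]; last by rewrite eqx.
  by rewrite eqx ?eqy // (ltn_trans ltzy).
- subst y; exists x => [z ltzx|]; first by rewrite eqx ?eqy.
  exact: ltn_trans lty.
Qed.

Lemma lexlt_asym f g : lexlt f g -> lexlt g f -> False.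
Proof. by move=> fg /(lexlt_trans fg); rewrite lexlt_irr. Qed.

Lemma eq_lexlt f f' g g' : f =1 f' -> g =1 g' -> lexlt f g = lexlt f' g'.
Proof.
move=> eqf eqg; apply: eq_existsb => x; rewrite eqf eqg; congr (_ && _).
by apply: eq_forallb => y; rewrite eqf eqg.
Qed.

End Lexicographic.

(** * Standard tableaux are determined and ordered by their row words *)

Section Standard.

Variables (n : nat) (mu : seq nat).
Hypothesis mu_sorted : sorted geq mu.
Implicit Types (T U : tableau n mu) (x y : 'I_n).

Lemma pos_inj T : injective (pos T).
Proof. by move=> x y /(congr1 (sval T)); rewrite !posK. Qed.

Lemma rowof_inj T x y : rowof T x = rowof T y -> colof T x = colof T y -> x = y.
Proof. by move=> er ec; apply: (@pos_inj T); apply: box_eq. Qed.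

Lemma eq_pos T U : pos T =1 pos U -> T = U.
Proof.
move=> eqp; apply/val_inj/ffunP => b /=.
by apply: (@pos_inj U); rewrite -eqp !Kpos.
Qed.

Definition row_inc T := forall x y,
  rowof T x = rowof T y -> (colof T x < colof T y)%N -> (x < y)%N.

Definition col_inc T := forall x y,
  colof T x = colof T y -> (rowof T x < rowof T y)%N -> (x < y)%N.

Lemma standardP T : reflect (row_inc T /\ col_inc T) (is_standard T).
Proof.
apply: (iffP forallP) => [stdT|[rT cT] b].
  by split=> x y exy ltxy; have /forallP/(_ (pos T y)) := stdT (pos T x);
    rewrite exy eqxx ltxy !posK => /andP[].
apply/forallP => b'; apply/andP; split; apply/implyP => /andP[/eqP e lt].
  by apply: rT; rewrite !Kpos.
by apply: cT; rewrite !Kpos.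
Qed.

(** Both letters are compared with the one in the row of [x] and the column of [y]: first along the
    row, then up the column. *)
Lemma standard_le T x y : is_standard T ->
  (rowof T x <= rowof T y)%N -> (colof T x <= colof T y)%N -> (x <= y)%N.
Proof.
move=> /standardP[rT cT] ler lec.
have [d dr dc] := box_corner mu_sorted ler.
have xd : (x <= sval T d)%N.
  move: lec; rewrite leq_eqVlt => /orP[/eqP ec|lt].
    suff -> : d = pos T x by rewrite posK.
    by apply: box_eq; rewrite // dc.
  by apply/ltnW/rT; rewrite Kpos ?dr ?dc.
apply: leq_trans xd _.
move: ler; rewrite leq_eqVlt => /orP[/eqP er|lt].
  suff -> : d = pos T y by rewrite posK.
  by apply: box_eq; rewrite // dr.
by apply/ltnW/cT; rewrite Kpos ?dr ?dc.
Qed.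

(* If the positions of x were comparable, the letter that one tableau puts in
   the smaller one would precede x, hence sit there in both tableaux. *)
Lemma standard_first_diff T U x : is_standard U ->
  (forall y, (y < x)%N -> pos T y = pos U y) -> pos T x <> pos U x ->
  (rowof T x <= rowof U x)%N -> (colof U x < colof T x)%N.
Proof.
move=> stdU eqTU neqx ler; rewrite ltnNge; apply/negP => lec.
set y := sval U (pos T x); have ltyx : (y < x)%N.
  have : (y <= x)%N by apply: (standard_le stdU); rewrite Kpos.
  rewrite leq_eqVlt => /orP[/eqP/val_inj eyx|//].
  by case: neqx; rewrite -eyx Kpos eyx.
have := eqTU y ltyx; rewrite Kpos => /(@pos_inj T) eyx.
by move: ltyx; rewrite eyx ltnn.
Qed.

(** At the first letter placed differently, equal rows would let [standard_first_diff] make each of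
    its two columns strictly smaller than the other. *)
Lemma standard_eq_pos T U x : is_standard T -> is_standard U ->
  (forall y, (y < x)%N -> rowof T y = rowof U y) ->
  forall y, (y < x)%N -> pos T y = pos U y.
Proof.
move=> stdT stdU eqr y; have [m] := ubnP (val y).
elim: m y => // m IHm y leym ltyx; apply/eqP/negP => /negP/eqP neq.
have eqTU (z : 'I_n) : (z < y)%N -> pos T z = pos U z.
  by move=> ltzy; apply: IHm; [apply: leq_trans ltzy leym|apply: ltn_trans ltyx].
have e := eqr y ltyx.
have := standard_first_diff stdU eqTU neq; rewrite e => /(_ (leqnn _)) lt1.
have := @standard_first_diff U T y stdT (fun z lt => esym (eqTU z lt)) (nesym neq).
by rewrite e => /(_ (leqnn _)); rewrite ltnNge ltnW.
Qed.

Lemma standard_rows_inj T U : is_standard T -> is_standard U ->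
  (forall x, rowof T x = rowof U x) -> T = U.
Proof.
move=> stdT stdU eqr; apply: eq_pos => y; apply/eqP/negP => /negP/eqP neq.
(* [standard_eq_pos] reaches the letters strictly below a given one; the two-sided comparison is
   repeated for that letter itself. *)
have eqTU := standard_eq_pos stdT stdU (fun y _ => eqr y).
have := standard_first_diff stdU (eqTU y) neq.
rewrite eqr => /(_ (leqnn _)) lt1.
have := @standard_first_diff U T y stdT (fun z lt => esym (eqTU y z lt)) (nesym neq).
by rewrite eqr => /(_ (leqnn _)); rewrite ltnNge ltnW.
Qed.

(** By [standard_first_diff], equal rows at the first displaced letter contradict the weak northwest
    condition; conversely, a smaller row in [S] forces a larger column in [S]. *)
Lemma syt_ltE (S T : SYT n mu) :
  syt_lt S T = lexlt (fun x => rowof (sval S) x) (fun x => rowof (sval T) x).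
Proof.
apply/existsP/lexltP => [[x /and4P[/eqP neqx /forallP eqx ler lec]]|[x eqx ltx]].
  have {}eqx (y : 'I_n) : (y < x)%N -> pos (sval S) y = pos (sval T) y.
    by move=> ltyx; apply/eqP/(implyP (eqx y)).
  exists x => [y /eqx -> //|]; rewrite ltn_neqAle ler andbT.
  apply/negP => /eqP er; have := standard_first_diff (svalP S)
    (fun y lt => esym (eqx y lt)) (nesym neqx).
  by rewrite er => /(_ (leqnn _)); rewrite ltnNge lec.
have {}eqx := standard_eq_pos (svalP S) (svalP T) eqx.
have neqx : pos (sval S) x <> pos (sval T) x by move=> e; rewrite e ltnn in ltx.
exists x; apply/and4P; split; [exact/eqP| |exact: ltnW|].
  by apply/forallP => y; apply/implyP => /eqx ->.
exact/ltnW/(standard_first_diff (svalP T) eqx neqx)/ltnW.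
Qed.

Lemma syt_le_order :
  [/\ reflexive (@syt_le n mu), antisymmetric (@syt_le n mu),
      transitive (@syt_le n mu) & total (@syt_le n mu)].
Proof.
split.
- by move=> S; rewrite /syt_le eqxx.
- move=> S T; rewrite /syt_le (eq_sym T) !syt_ltE => /andP[/orP[/eqP //|lt1]].
  by case/orP=> [/eqP //|lt2]; case: (lexlt_asym lt1 lt2).
- move=> T S U; rewrite /syt_le => /orP[/eqP -> //|]; rewrite syt_ltE => lt1.
  case/orP=> [/eqP <-|]; first by rewrite syt_ltE lt1 orbT.
  by rewrite !syt_ltE => /(lexlt_trans lt1) ->; rewrite orbT.
move=> S T; rewrite /syt_le !syt_ltE.
case: (lexlt_total (fun x => rowof (sval S) x) (fun x => rowof (sval T) x)).
- move=> eqr; suff -> : S = T by rewrite eqxx.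
  apply: val_inj.
  exact: (standard_rows_inj (svalP S) (svalP T) eqr).
- by move=> ->; rewrite orbT.
- by move=> ->; rewrite !orbT.
Qed.

End Standard.

(** * Least tabloids of polytabloids *)

Section TrailingTabloid.

Variables (F : fieldType) (n : nat) (mu : seq nat).
Implicit Types (T U : tableau n mu) (x y : 'I_n) (s : 'S_n).

Local Notation "{{ T }}" := (enum_rank (tabloid_of T)).
Local Notation rows T := (fun x => rowof T x).

Lemma tabloid_of_eq T U :
  (tabloid_of T == tabloid_of U) = [forall x, rowof T x == rowof U x].
Proof.
apply/eqP/forallP => [/(congr1 val) /= eqTU x|eqr].
  have : U \in row_class T by rewrite eqTU inE; apply/forallP.
  by rewrite inE eq_sym => /forallP/(_ x).
apply/val_inj/setP => V /=; rewrite !inE.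
by apply: eq_forallb => x; rewrite (eqP (eqr x)).
Qed.

Lemma tact_fix s T : tact s T = T -> s = 1%g.
Proof.
move=> eqT; apply/permP => x; rewrite perm1.
by apply: (@pos_inj _ _ T); rewrite -{1}eqT pos_tact.
Qed.

Lemma colof_tact T s x : col_stab T s -> colof (tact s T) x = colof T x.
Proof.
by move=> /forallP/(_ (s^-1%g x))/eqP; rewrite permKV pos_tactV.
Qed.

(** Had the first displaced letter gone south, its new cell would hold in [T] a smaller letter of
    the same column. That letter has not moved, so the cell would be occupied twice. *)
Lemma col_stab_first_diff T s : col_inc T -> col_stab T s -> s != 1%g ->
  exists2 x : 'I_n, (forall y : 'I_n, (y < x)%N -> pos (tact s T) y = pos T y)
             & (rowof T x < rowof (tact s T) x)%N.
Proof.
move=> cT sT s1; set U := tact s T.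
have colU y : colof U y = colof T y by exact: colof_tact.
have [|x eqx neqx] := @first_diff n (rows U) (rows T).
  move=> eqr; case/eqP: s1; apply: (@tact_fix _ T); apply: eq_pos => x.
  exact: box_eq.
exists x => [y /eqx|]; first by move=> er; apply: box_eq.
rewrite ltnNge leq_eqVlt; apply/norP; split; first exact/eqP.
apply/negP => ltx; set y := sval T (pos U x).
have ltyx : (y < x)%N by apply: cT; rewrite Kpos.
have : pos U y = pos U x.
  by rewrite -(Kpos T (pos U x)) -/y; apply: box_eq; [apply: eqx|].
by move/(@pos_inj _ _ U) => eyx; rewrite eyx ltnn in ltyx.
Qed.

(** [T] represents the least tabloid of [w] in the order of row words, with coefficient 1. *)
Definition trails T (w : 'rV[F]_#|{: tabloid n mu}|) : Prop :=
  w 0 {{T}} = 1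
  /\ forall U, w 0 {{U}} != 0 -> ~~ lexlt (rows U) (rows T).

(** Common form of [e_T] and [s_i e_T]: the identity contributes the least tabloid with sign 1, and
    no other term can cancel it. *)
Lemma trails_signed_sum T (P : pred 'S_n) (g : 'S_n -> tableau n mu) :
  P 1%g -> rows (g 1%g) =1 rows T ->
  (forall s, P s -> s != 1%g -> lexlt (rows T) (rows (g s))) ->
  trails T (\sum_(s | P s) (-1) ^+ s *: tabloid_vec F (tabloid_of (g s))).
Proof.
move=> P1 g1 gP.
have coefE U : (\sum_(s | P s) (-1) ^+ s *: tabloid_vec F (tabloid_of (g s)))
    0 {{U}} = \sum_(s | P s) (-1) ^+ s * (tabloid_of (g s) == tabloid_of U)%:R.
  rewrite summxE; apply: eq_bigr => s _; rewrite !mxE eqxx /=.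
  by rewrite (inj_eq enum_rank_inj) eq_sym.
split.
  rewrite coefE (bigD1 1%g) //= big1 ?addr0 => [|s /andP[Ps s1]].
    rewrite odd_perm1 expr0 mul1r tabloid_of_eq.
    have -> // : [forall x, rows (g 1%g) x == rows T x].
    by apply/forallP => x; apply/eqP.
  rewrite tabloid_of_eq; case: forallP => [eqr|_]; last by rewrite mulr0.
  have := gP s Ps s1; rewrite (eq_lexlt (g' := rows T) (frefl _)) ?lexlt_irr //.
  by move=> x; apply/eqP.
move=> U; rewrite coefE; apply: contraNN => ltU; apply/eqP/big1 => s Ps.
rewrite tabloid_of_eq; case: forallP => [/= eqr|_]; last by rewrite mulr0.
have {}ltU : lexlt (rows (g s)) (rows T).
  by rewrite (eq_lexlt (f' := rows U) (g' := rows T)) // => x; apply/eqP.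
have [s1|s1] := eqVneq s 1%g; last by case: (lexlt_asym ltU (gP s Ps s1)).
by rewrite s1 (eq_lexlt (f' := rows T) (g' := rows T)) ?lexlt_irr // in ltU.
Qed.

Lemma col_stab1 T : col_stab T 1%g.
Proof. by apply/forallP => x; rewrite perm1. Qed.

Lemma polytabloid_trails T : col_inc T -> trails T (polytabloid F T).
Proof.
move=> cT; apply: trails_signed_sum => [||s sT s1]; first exact: col_stab1.
  by move=> x; rewrite tact1.
have [x eqx ltx] := col_stab_first_diff cT sT s1.
by apply/lexltP; exists x => // y /eqx ->.
Qed.

Lemma adj_lo (i : 'I_n.-1) : adj i (lo i) = hi i. Proof. exact: tpermL. Qed.
Lemma adj_hi (i : 'I_n.-1) : adj i (hi i) = lo i. Proof. exact: tpermR. Qed.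
Lemma adjV (i : 'I_n.-1) : (adj i)^-1%g = adj i. Proof. exact: tpermV. Qed.

Lemma adj_fix (i : 'I_n.-1) x : x != i :> nat -> x != i.+1 :> nat -> adj i x = x.
Proof. by move=> ne1 ne2; rewrite /adj tpermD // -val_eqE eq_sym. Qed.

Lemma pos_adj (i : 'I_n.-1) T x : pos (tact (adj i) T) x = pos T (adj i x).
Proof. by rewrite pos_tactV adjV. Qed.

(* Moving letters up along columns first affects a letter that goes north; since
   i and i+1 share a row of T, this survives their exchange. *)
Lemma polytabloid_adj_trails T (i : 'I_n.-1) : col_inc T ->
  rowof T (lo i) = rowof T (hi i) -> trails T (polytabloid F (tact (adj i) T)).
Proof.
move=> cT eqr; rewrite -polytabloidJ mulmx_suml.
under eq_bigr do rewrite -scalemxAl tabloid_vecJ.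
have rowTadj x : rowof T (adj i x) = rowof T x.
  have [/val_inj->|nelo] := @eqP _ (x : nat) (lo i); first by rewrite adj_lo.
  have [/val_inj->|nehi] := @eqP _ (x : nat) (hi i); first by rewrite adj_hi.
  by rewrite adj_fix; [|apply/eqP|apply/eqP].
apply: (@trails_signed_sum T _ (fun s => tact (adj i) (tact s T))) => [||s sT s1].
- exact: col_stab1.
- by move=> x; rewrite tact1 pos_adj.
have [x eqx ltx] := col_stab_first_diff cT sT s1; set U := tact s T in eqx ltx *.
(* A first displaced letter other than [lo i] and [hi i] remains the first difference after the
   exchange; for [hi i] the difference moves to [lo i]. The case of [lo i] comes last. *)
apply/lexltP; have [ltxi|gtxi|exi] := ltngtP x i.
- exists x => [y ltyx|]; last by rewrite pos_adj adj_fix //; lia.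
  by rewrite pos_adj adj_fix ?eqx //; lia.
- have [exi|ltix] := eqVneq (x : nat) i.+1.
    have {}exi : x = hi i by apply: val_inj.
    subst x; exists (lo i) => [y ltyi|]; last by rewrite pos_adj adj_lo eqr.
    rewrite /= in ltyi.
    by rewrite pos_adj adj_fix ?eqx //=; lia.
  exists x => [y ltyx|]; last by rewrite pos_adj adj_fix //; lia.
  rewrite pos_adj eqx ?rowTadj //.
  have [/val_inj->|nelo] := @eqP _ (y : nat) (lo i); first by rewrite adj_lo /=; lia.
  have [/val_inj->|nehi] := @eqP _ (y : nat) (hi i); first by rewrite adj_hi /=; lia.
  by rewrite adj_fix; [|apply/eqP|apply/eqP].
have {}exi : x = lo i by apply: val_inj.
subst x.
have colU y : colof U y = colof T y by exact: colof_tact.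
(* The exchange gives [lo i] the cell of [hi i] in [U], so [hi i] must not have gone south.
   Otherwise its new cell held in [T] either [lo i], which shares its row and hence not its column,
   or a smaller letter that has not moved. *)
have le_hi : (rowof T (hi i) <= rowof U (hi i))%N.
  rewrite leqNgt; apply/negP => lt; set y := sval T (pos U (hi i)).
  have ltyx : (y < hi i)%N by apply: cT; rewrite Kpos.
  move: ltyx; rewrite /= ltnS leq_eqVlt => /orP[/eqP/= eyi|ltyi].
    have {}eyi : y = lo i by apply: val_inj.
    have ec : colof T (lo i) = colof T (hi i) by rewrite -eyi Kpos.
    by have /(congr1 val) /= := rowof_inj eqr ec; lia.
  have : pos U y = pos U (hi i) by rewrite eqx // Kpos.
  by move/(@pos_inj _ _ U)/(congr1 val) => /=; lia.
(* If [hi i] kept its row, the first difference is at [hi i], which takes over the higher row of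
   [lo i]; otherwise it is at [lo i]. *)
move: le_hi; rewrite leq_eqVlt => /orP[/eqP e|lt].
  exists (hi i) => [y|]; last by rewrite pos_adj adj_hi -eqr.
  rewrite /= ltnS leq_eqVlt => /orP[/eqP/= eyi|ltyi].
    have -> : y = lo i by apply: val_inj.
    by rewrite pos_adj adj_lo -e.
  by rewrite pos_adj adj_fix ?eqx //; lia.
exists (lo i) => [y /= ltyi|]; last by rewrite pos_adj adj_lo eqr.
by rewrite pos_adj adj_fix ?eqx //; lia.
Qed.

End TrailingTabloid.

(** * Garnir relations *)

Lemma ltn_sum_strict (I : finType) (E1 E2 : I -> nat) (i0 : I) :
  (forall i, E1 i <= E2 i)%N -> (E1 i0 < E2 i0)%N ->
  (\sum_i E1 i < \sum_i E2 i)%N.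
Proof.
move=> le12 lt12; rewrite (bigD1 i0) //= [X in (_ < X)%N](bigD1 i0) //=.
by rewrite -addSn leq_add // leq_sum.
Qed.

Section Garnir.

Variables (F : fieldType) (charF : [pchar F]%R =i pred0).
Variables (n : nat) (mu : seq nat).
Hypothesis mu_sorted : sorted geq mu.
Implicit Types (T U : tableau n mu) (x y z : 'I_n) (s u : 'S_n).

Lemma tabloid_of_tact s T U : tabloid_of T = tabloid_of U ->
  tabloid_of (tact s T) = tabloid_of (tact s U).
Proof.
move/eqP; rewrite tabloid_of_eq => /forallP eqr.
by apply/eqP; rewrite tabloid_of_eq; apply/forallP => x; rewrite !pos_tactV.
Qed.

Lemma polytabloid_col_stab T s : col_stab T s ->
  polytabloid F (tact s T) = (-1) ^+ s *: polytabloid F T.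
Proof.
move=> sT; rewrite /polytabloid [in RHS](reindex_inj (mulgI s)) /= scaler_sumr.
apply: eq_big => [u|u _]; last first.
  by rewrite tactM scalerA odd_permM -signr_addb addKb.
apply/forallP/forallP => uT x.
  by rewrite permM -!(colof_tact _ sT) (eqP (uT (s x))) !(colof_tact _ sT) (forallP sT).
have := uT (s^-1%g x); rewrite permM permKV => /eqP ux.
by rewrite !(colof_tact _ sT) ux -{2}(permKV s x) eq_sym (forallP sT).
Qed.

Lemma opp_self_eq0 m (w : 'rV[F]_m) : w = - w -> w = 0.
Proof.
move=> /eqP; rewrite -addr_eq0 -mulr2n -scaler_nat scaler_eq0.
by have /pcharf0P -> := charF => /= /eqP.
Qed.

(** After expanding [e_T], the antisymmetrizer of [Z] acts on tabloids having two letters [a], [b]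
    of [Z] in one row. The transposition of [a] and [b] fixes such a tabloid and reverses the
    signs. *)
Lemma garnir_sum0 T (Z : {set 'I_n}) :
  (forall s, col_stab T s -> exists a b, [/\ a \in Z, b \in Z, a != b
     & rowof (tact s T) a = rowof (tact s T) b]) ->
  \sum_(s | perm_on Z s) (-1) ^+ s *: polytabloid F (tact s T) = 0.
Proof.
move=> coll.
transitivity (\sum_(u | col_stab T u) (-1) ^+ u *: \sum_(s | perm_on Z s)
    (-1) ^+ s *: tabloid_vec F (tabloid_of (tact s (tact u T)))).
  under [RHS]eq_bigr do rewrite scaler_sumr.
  rewrite [RHS]exchange_big /=; apply: eq_bigr => s _.
  rewrite -polytabloidJ mulmx_suml scaler_sumr; apply: eq_bigr => u _.
  by rewrite -scalemxAl tabloid_vecJ !scalerA mulrC.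
rewrite big1 // => u uT; set U := tact u T.
have [a [b [aZ bZ neab eqr]]] := coll u uT.
rewrite (_ : \sum_(s | _) _ = 0) ?scaler0 //; apply: opp_self_eq0.
rewrite {1}(reindex_inj (mulgI (tperm a b))) /= -sumrN.
have abZ : perm_on Z (tperm a b).
  by apply/subsetP => x; rewrite inE; case: tpermP => [->|->|]; rewrite ?eqxx.
apply: eq_big => [s|s _].
  apply/idP/idP => sZ; last exact: perm_onM.
  by rewrite -(mulKg (tperm a b) s) tpermV perm_onM.
rewrite tactM odd_mul_tperm neab signr_addb expr1 mulN1r scaleNr.
congr (- (_ *: tabloid_vec _ _)); apply: tabloid_of_tact; apply/eqP.
rewrite tabloid_of_eq; apply/forallP => x; rewrite pos_tactV tpermV -/U.
by case: tpermP => [->|->|]; rewrite ?eqr.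
Qed.

Definition garnir_set T x y : {set 'I_n} :=
  [set z | (colof T z == colof T x) && (rowof T x <= rowof T z)%N
        || (colof T z == colof T y) && (rowof T z <= rowof T y)%N].

(** Pigeonhole: in [U], the letters of the Garnir set lie in rows that meet the column of [x]. In
    [T], the set without [y] already fills all these rows: the column of [x] from [x] northwards,
    the column of [y] below it. *)
Lemma garnir_collision T U x y :
  rowof T x = rowof T y -> (colof T x < colof T y)%N ->
  (forall z, colof U z = colof T z) ->
  exists a b, [/\ a \in garnir_set T x y, b \in garnir_set T x y, a != b
     & rowof U a = rowof U b].
Proof.
move=> eqr ltc colU; set Z := garnir_set T x y.
have yZ : y \in Z by rewrite inE eqxx leqnn orbT.
pose f V z := (sval (pos V z : box mu)).1.
have [/existsP[a /existsP[b /and4P[aZ bZ neab /eqP eqf]]]|none] := boolP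
    [exists a, exists b, [&& a \in Z, b \in Z, a != b & f U a == f U b]].
  by exists a, b; split=> //; exact: (congr1 val eqf).
have injf : {in Z &, injective (f U)}.
  move=> a b aZ bZ eqf; apply/eqP; apply: contraNT none => neab.
  by apply/existsP; exists a; apply/existsP; exists b; rewrite aZ bZ neab eqf /=.
pose R := [set r : 'I_(size mu) | (colof T x < nth 0 mu r)%N].
suff: (#|Z| <= #|Z :\ y|)%N by rewrite {1}(cardsD1 y Z) yZ ltnn.
rewrite -(card_in_imset injf); apply: leq_trans (leq_imset_card (f T) _).
apply: subset_leq_card.
have ZR : f U @: Z \subset R.
  apply/subsetP => r /imsetP[z zZ ->]; rewrite inE.
  apply: leq_ltn_trans (svalP (pos U z)).
  rewrite -/(box_col _) colU; move: zZ; rewrite inE.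
  by case/orP=> /andP[/eqP-> _] //; apply: ltnW.
apply: subset_trans ZR _; apply/subsetP => r; rewrite inE => ltr.
have lth : (colof T x < head 0 mu)%N.
  by apply: leq_trans ltr _; rewrite -nth0; apply: nth_sorted_geq.
pose d : box mu := exist _ (r, Ordinal lth) ltr.
have [ler|ltr0] := leqP (rowof T x) r.
  apply/imsetP; exists (sval T d); last by rewrite /f Kpos.
  rewrite !inE Kpos eqxx ler orTb andbT.
  by apply/eqP => /(congr1 (pos T)); rewrite Kpos => e; rewrite -e ltnn in ltc.
have [|e er ec] := @box_corner _ d (pos T y) mu_sorted.
  by rewrite -eqr; exact: ltnW.
apply/imsetP; exists (sval T e); last by rewrite /f Kpos; exact/esym/val_inj.
rewrite !inE Kpos ec eqxx er -eqr (ltnW ltr0 : (box_row d <= _)%N) orbT andbT.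
apply/eqP => /(congr1 (pos T)); rewrite Kpos => eqe.
by move: ltr0; rewrite eqr -eqe er ltnn.
Qed.

(** Numerical measures for straightening: they grow when larger letters move east, respectively
    north. *)
Definition col_weight T := (\sum_(z < n) z * colof T z)%N.
Definition row_weight T := (\sum_(z < n) z * rowof T z)%N.

Lemma col_weight_tact T s : col_weight (tact s T) = (\sum_(z < n) s z * colof T z)%N.
Proof.
rewrite /col_weight (reindex_inj (@perm_inj _ s)).
by apply: eq_bigr => z _; rewrite pos_tact.
Qed.

(* Rearrangement inequality: letters of the lower part of the eastern column are
   all smaller than those of the upper part of the western one. *)
Lemma garnir_col_weight T x y s : col_inc T ->
  rowof T x = rowof T y -> (colof T x < colof T y)%N -> (y < x)%N ->
  perm_on (garnir_set T x y) s -> ~~ col_stab T s ->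
  (col_weight T < col_weight (tact s T))%N.
Proof.
move=> cT eqr ltc ltyx sZ /forallPn[z0 nez0]; rewrite col_weight_tact.
pose c z := colof T z; rewrite -!/(c _) in ltc nez0.
have Wc : col_weight T = (\sum_(z < n) s z * c (s z))%N.
  by rewrite /col_weight (reindex_inj (@perm_inj _ s)).
have Sc : (\sum_z c (s z) = \sum_z c z)%N.
  by rewrite [RHS](reindex_inj (@perm_inj _ s)).
have AB z : z \in garnir_set T x y ->
    (c z = c x /\ (x <= z)%N) \/ (c z = c y /\ (z <= y)%N).
  rewrite inE => /orP[]/andP[/eqP ec le]; [left|right]; split=> //.
    move: le; rewrite leq_eqVlt => /orP[/eqP er|lt].
      by rewrite (rowof_inj er (esym ec)).
    exact/ltnW/cT.
  move: le; rewrite leq_eqVlt => /orP[/eqP er|lt].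
    by rewrite (rowof_inj er ec).
  exact/ltnW/cT.
(* Rearranged, [(2 s z - (x + y)) (c z - c (s z)) >= 0]: the midpoint of [y] and [x] separates the
   letters of the two columns. The terms in [x + y] cancel in the sum, as [s] permutes the
   letters. *)
have term z : (2 * (s z * c (s z)) + (x + y) * c z
    <= 2 * (s z * c z) + (x + y) * c (s z)
    ?= iff (c (s z) == c z))%N.
  apply/leqifP; have [<-//|neq] := eqVneq (c (s z)) (c z).
  have zZ : z \in garnir_set T x y.
    by apply: contraNT neq => zZ; rewrite (out_perm sZ zZ).
  have szZ : s z \in garnir_set T x y by rewrite perm_closed.
  have [[e1 l1]|[e1 l1]] := AB z zZ; have [[e2 l2]|[e2 l2]] := AB _ szZ;
    move: neq; rewrite e1 e2 ?eqxx // => _; nia.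
have := @ltn_sum_strict _ _ _ z0 (fun z => leq_of_leqif (term z)).
rewrite (ltn_leqif (term z0)) nez0 => /(_ isT).
rewrite !big_split -!big_distrr /= Sc -Wc !big1_eq.
set S := (\sum_(z < n) s z * c z)%N; rewrite -[X in _ -> (_ < X)%N]/S.
by rewrite ltn_add2r; lia.
Qed.

(* Among the tableaux violating the claim, one with maximal column weight and
   then maximal row weight is standard: exchanging two letters in a column
   raises the row weight, and a Garnir relation raises the column weight. *)
Lemma standard_polytabloids_span m (M : 'M[F]_(m, _)) :
  (forall T, is_standard T -> (polytabloid F T <= M)%MS) ->
  forall T, (polytabloid F T <= M)%MS.
Proof.
move=> stdM T0; apply/negP => /negP bad0.
have [T1 bad1 max1] := @arg_maxnP _ T0
  (fun T => ~~ (polytabloid F T <= M)%MS) col_weight bad0.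
(* The trivial second conjunct makes [T1] a witness for the next maximization, over violators of the
   same column weight. *)
have /= {bad1}bad1 : ~~ (polytabloid F T1 <= M)%MS && (col_weight T1 == col_weight T1).
  by rewrite bad1 eqxx.
have [T /= /andP[badT /eqP eqW] maxT] := @arg_maxnP _ T1
  (fun T => ~~ (polytabloid F T <= M)%MS && (col_weight T == col_weight T1))
  row_weight bad1.
have {max1}goodW U : (col_weight T < col_weight U)%N -> (polytabloid F U <= M)%MS.
  by rewrite eqW ltnNge; apply: contraNT => /max1.
have {maxT}goodV U : col_weight U = col_weight T ->
    (row_weight T < row_weight U)%N -> (polytabloid F U <= M)%MS.
  move=> eqU; rewrite ltnNge; apply: contraNT => badU; apply: maxT.
  by rewrite badU eqU eqW /=.
move/negP: badT => badT; case: (badT); apply/stdM/standardP.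
have cT : col_inc T.
  move=> x y eqc ltr; rewrite ltnNge leq_eqVlt.
  apply/negP => /orP[/eqP/val_inj e|ltyx]; first by rewrite e ltnn in ltr.
  have neyx : y != x by rewrite -val_eqE /= neq_ltn ltyx.
  set s := tperm x y.
  have sT : col_stab T s.
    by apply/forallP => z; rewrite /s; case: tpermP => // ->; rewrite eqc.
  case: badT; have := goodV (tact s T); rewrite (polytabloid_col_stab sT).
  rewrite (eqmx_scale _ (negbT (signr_eq0 _ _))); apply.
    by apply: eq_bigr => z _; rewrite (colof_tact _ sT).
  rewrite /row_weight (bigD1 x) //= (bigD1 y) //=.
  rewrite [X in (_ < X)%N](bigD1 x) //= [X in (_ < _ + X)%N](bigD1 y) //=.
  rewrite !pos_tactV tpermV tpermL tpermR.
  rewrite [X in (_ < _ + (_ + X))%N](eq_bigr (fun z => z * rowof T z)%N); first by nia.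
  by move=> z /andP[nezx nezy]; rewrite pos_tactV tpermV tpermD // eq_sym.
split=> // x y eqr ltc; rewrite ltnNge leq_eqVlt.
apply/negP => /orP[/eqP/val_inj e|ltyx]; first by rewrite e ltnn in ltc.
case: badT; set Z := garnir_set T x y.
have := @garnir_sum0 T Z (fun s sT =>
  garnir_collision eqr ltc (fun z => colof_tact z sT)).
(* Column-preserving terms all equal [e_T], the two signs cancelling, and their number is invertible
   in characteristic 0; the remaining terms have larger column weight. *)
rewrite (bigID (col_stab T)) /=.
under eq_bigr => s /andP[_ sT].
  rewrite (polytabloid_col_stab sT) scalerA -expr2 sqrr_sign scale1r; over.
rewrite sumr_const -scaler_nat => /eqP; rewrite addr_eq0 => /eqP eqS.
set k := #|_| in eqS; have k0 : k%:R != 0 :> F.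
  have /pcharf0P -> := charF; rewrite -lt0n; apply/card_gt0P; exists 1%g.
  by rewrite unfold_in /= perm_on1 col_stab1.
rewrite -(eqmx_scale _ k0) eqS eqmx_opp summx_sub // => s /andP[sZ sT].
by rewrite scalemx_sub // goodW // (@garnir_col_weight T x y).
Qed.

End Garnir.

(** * Standardization *)

Lemma consecutive_letters n (x y : 'I_n) : y = x.+1 :> nat ->
  exists2 i : 'I_n.-1, lo i = x & hi i = y.
Proof.
move=> ey; have lt : (x < n.-1)%N by have := ltn_ord y; lia.
by exists (Ordinal lt); apply: val_inj.
Qed.

Section Standardization.

Variables (n : nat) (mu : seq nat).
Hypothesis mu_part : is_intpart n mu.
Variable N : nat.
Implicit Types (T : tableau n mu) (t : {ffun box mu -> 'I_N}).

Let mu_sorted : sorted geq mu.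
Proof. by case/and3P: mu_part. Qed.

Definition descents T : {set 'I_n.-1} :=
  [set i | (rowof T (lo i) < rowof T (hi i))%N].

(** The index condition of [fundamental (descents T)], carried over from words to fillings of
    boxes. *)
Definition compatible T t : bool :=
  [forall i : 'I_n.-1,
     (t (pos T (lo i)) <= t (pos T (hi i)))%N
       && ((i \in descents T) ==> (t (pos T (lo i)) < t (pos T (hi i)))%N)].

Definition semistandard t : bool :=
  [forall b, forall b',
     ((box_row b == box_row b') && (box_col b < box_col b')%N ==> (t b <= t b')%N)
     && ((box_col b == box_col b') && (box_row b < box_row b')%N ==> (t b < t b')%N)].

Lemma semistandardP t : reflect
  ((forall b b', box_row b = box_row b' -> (box_col b < box_col b')%N ->
      (t b <= t b')%N)
   /\ (forall b b', box_col b = box_col b' -> (box_row b < box_row b')%N ->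
      (t b < t b')%N))
  (semistandard t).
Proof.
apply: (iffP forallP) => [sst|[rt ct] b].
  by split=> b b' e lt; have /forallP/(_ b') := sst b; rewrite e eqxx lt => /andP[].
by apply/forallP => b'; apply/andP; split; apply/implyP => /andP[/eqP e lt];
  [apply: rt|apply: ct].
Qed.

(* Orders boxes by entry, ties being broken from west to east. *)
Definition std_key t (b : box mu) : nat := (t b * head 0 mu + box_col b)%N.

Lemma box_col_lt (b : box mu) : (box_col b < head 0 mu)%N.
Proof. exact: ltn_ord. Qed.

(** Columns are smaller than [head 0 mu], so the key is a two-digit expansion. *)
Lemma std_key_lt t b b' : (std_key t b < std_key t b')%N =
  (t b < t b')%N || (t b == t b' :> nat) && (box_col b < box_col b')%N.
Proof.
rewrite /std_key; have := box_col_lt b; have := box_col_lt b'.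
move: (box_col b) (box_col b') => c c'; set K := head _ _ => ltc' ltc.
case: (ltngtP (t b) (t b')) => [lt|gt|->] /=; last by rewrite ltn_add2l.
  have : ((t b).+1 * K <= t b' * K)%N by rewrite leq_mul2r lt orbT.
  by rewrite mulSn; move: (t b * K)%N (t b' * K)%N => p q; clearbody K; lia.
have : ((t b').+1 * K <= t b * K)%N by rewrite leq_mul2r gt orbT.
by rewrite mulSn; move: (t b * K)%N (t b' * K)%N => p q; clearbody K; lia.
Qed.

(** It suffices to treat consecutive letters. If their entries tie, there is no descent, so the
    second letter lies weakly south of the first and, [T] being standard, strictly east. *)
Lemma compatible_key T t : is_standard T -> compatible T t ->
  forall x y : 'I_n, (x < y)%N -> (std_key t (pos T x) < std_key t (pos T y))%N.
Proof.
move=> stdT /forallP cTt x y.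
have [m] := ubnP (y : nat); elim: m y => // m IHm y leym ltxy.
have lt1 : (y.-1 < n)%N by have := ltn_ord y; lia.
have [i lo_i hi_i] : exists2 i : 'I_n.-1, lo i = Ordinal lt1 & hi i = y.
  by apply: consecutive_letters => /=; lia.
have step : (std_key t (pos T (lo i)) < std_key t (pos T (hi i)))%N.
  have /andP[le12 /implyP lt12] := cTt i; rewrite std_key_lt.
  move: le12; rewrite leq_eqVlt => /orP[/eqP e|-> //]; rewrite e eqxx ltnn /=.
  rewrite ltnNge; apply/negP => lec.
  have : (rowof T (hi i) <= rowof T (lo i))%N.
    by rewrite leqNgt; apply/negP => lt; move: lt12; rewrite inE lt e ltnn => /(_ isT).
  by move/(standard_le mu_sorted stdT)/(_ lec) => /=; lia.
rewrite hi_i in step; have [exi|neqx] := eqVneq x (lo i); first by rewrite exi.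
apply: ltn_trans step; apply: IHm; rewrite lo_i /=; first lia.
by move: neqx; rewrite lo_i -val_eqE /=; lia.
Qed.

(** Letters start at 0, so an entry counts the smaller letters, that is, the boxes of smaller key.
    Hence [t] determines [T]. *)
Lemma compatible_rank T t : is_standard T -> compatible T t ->
  forall b, sval T b = #|[set b' | (std_key t b' < std_key t b)%N]| :> nat.
Proof.
move=> stdT cTt b; have mono := compatible_key stdT cTt.
pose f k := pos T (widen_ord (ltnW (ltn_ord (sval T b))) k).
rewrite -[LHS]card_ord -(card_imset _ (f := f)).
  apply/eq_card => b'; rewrite !inE; apply/imsetP/idP => [[k _ ->]|].
    rewrite /f; set z := widen_ord _ k; have := mono z (sval T b) (ltn_ord k).
    by rewrite (Kpos T b).
  move=> lt; have ltT : (sval T b' < sval T b)%N.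
    rewrite ltnNge leq_eqVlt; apply/negP => /orP[/eqP/val_inj e|gt].
      by move: lt; rewrite -(Kpos T b) e Kpos ltnn.
    by have := mono _ _ gt; rewrite !Kpos ltnNge ltnW.
  exists (Ordinal ltT) => //; rewrite -[LHS](Kpos T); congr (pos T _); exact: val_inj.
by move=> k k' /(@pos_inj _ _ T)/(congr1 val)/= /val_inj.
Qed.

Lemma compatible_semistandard T t : is_standard T -> compatible T t -> semistandard t.
Proof.
move=> stdT cTt; have mono := compatible_key stdT cTt.
have [rT cT] := standardP T stdT.
apply/semistandardP; split=> b b' e lt.
  have /mono : (sval T b < sval T b')%N by apply: rT; rewrite !Kpos.
  by rewrite !Kpos std_key_lt => /orP[/ltnW //|/andP[/eqP->]].
have /mono : (sval T b < sval T b')%N by apply: cT; rewrite !Kpos.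
by rewrite !Kpos std_key_lt e ltnn andbF orbF.
Qed.

(** The tableau numbers the boxes by the rank of their key. *)
Lemma standardization t : semistandard t ->
  exists2 T : tableau n mu, is_standard T & compatible T t.
Proof.
case/semistandardP => rt ct; pose K := std_key t.
(* A tie in both entry and column is excluded by strictness along columns. *)
have K_inj : injective K.
  move=> b b' eK; have nlt : ~~ (K b < K b')%N /\ ~~ (K b' < K b)%N.
    by rewrite eK ltnn.
  case: nlt; rewrite /K !std_key_lt !negb_or !negb_and.
  case: (ltngtP (t b) (t b')) => //= et.
  case: (ltngtP (box_col b) (box_col b')) => //= ec.
  case: (ltngtP (box_row b) (box_row b')) => er _ _.
  - by have := ct _ _ ec er; rewrite et ltnn.
  - by have := ct _ _ (esym ec) er; rewrite et ltnn.
  - exact: box_eq.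
pose below b := [set b' | (K b' < K b)%N].
have below_lt b : (#|below b| < n)%N.
  rewrite -(card_box mu_part) -cardsT; apply: proper_card; rewrite properT.
  by apply/eqP => /setP/(_ b); rewrite !inE ltnn.
pose f := [ffun b => Ordinal (below_lt b)].
have f_mono b b' : (K b < K b')%N -> (f b < f b')%N.
  move=> lt; rewrite !ffunE /=; apply: proper_card; apply/properP; split.
    by apply/subsetP => d; rewrite !inE => /ltn_trans; apply.
  by exists b; rewrite !inE ?lt ?ltnn.
have f_inj : injective f.
  move=> b b' ef; apply: K_inj; apply/eqP.
  by case: ltngtP => // /f_mono; rewrite ef ltnn.
have fT : is_tableau f.
  apply/andP; split; first exact/injectiveP.
  apply/forallP => x; apply: inj_card_onto f_inj _ x.
  by rewrite card_ord (card_box mu_part).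
pose T : tableau n mu := exist _ f fT.
have stdT : is_standard T.
  apply/forallP => b; apply/forallP => b'.
  apply/andP; split; apply/implyP => /andP[/eqP e lt]; apply: f_mono;
    rewrite /K std_key_lt.
    have := rt _ _ e lt; rewrite leq_eqVlt => /orP[/eqP->|-> //].
    by rewrite eqxx lt orbT.
  by rewrite ct.
exists T => //; apply/forallP => i.
have : (K (pos T (lo i)) < K (pos T (hi i)))%N.
  rewrite ltnNge leq_eqVlt; apply/negP => /orP[/eqP/K_inj|/f_mono].
    by move/(@pos_inj _ _ T)/(congr1 val) => /=; lia.
  by rewrite -[f]/(sval T) !posK /=; lia.
rewrite /K std_key_lt => /orP[lt|/andP[/eqP et ltc]].
  by rewrite (ltnW lt) lt implybT.
rewrite et leqnn inE /=; apply/implyP => ltr.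
(* No tie at a descent: the box in the row of [lo i] and the column of [hi i] would have an entry at
   least that of [lo i] and less than the equal entry of [hi i]. *)
have [d dr dc] := box_corner mu_sorted (ltnW ltr).
have := rt _ d (esym dr); rewrite dc => /(_ ltc) le1.
by have := ct d _ dc; rewrite dr => /(_ ltr); lia.
Qed.

(** Each semistandard filling is compatible with exactly one standard tableau, so exchanging the two
    sums leaves one term per filling. *)
Lemma schur_fundamental :
  schur mu N = \sum_(T : SYT n mu) fundamental (descents (sval T)) N.
Proof.
have fundE (T : SYT n mu) : fundamental (descents (sval T)) N
    = \sum_(t | compatible (sval T) t) \prod_(b : box mu) 'X_(t b).
  rewrite /fundamental; case: T => T stdT /=.
  pose h (t : {ffun box mu -> 'I_N}) := [ffun x => t (pos T x)].
  rewrite (reindex h); last first.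
    exists (fun s : {ffun 'I_n -> 'I_N} => [ffun b => s (sval T b)]) => s _;
      by apply/ffunP => b; rewrite !ffunE ?Kpos ?posK.
  apply: eq_big => [t|t _].
    by apply: eq_forallb => i; rewrite !ffunE.
  rewrite (reindex (sval T)); last first.
    by exists (pos T) => b _; rewrite ?Kpos ?posK.
  by apply: eq_bigr => b _; rewrite ffunE Kpos.
under eq_bigr do rewrite fundE.
rewrite (exchange_big_dep semistandard) /=; last first.
  by move=> T t _; exact: compatible_semistandard (svalP T).
rewrite /schur; apply: eq_bigr => t sst.
have [T stdT cTt] := standardization sst.
rewrite (big_pred1 (exist _ T stdT : SYT n mu)) // => U /=.
apply/idP/eqP => [cUt|->] //; apply: val_inj => /=.
apply/val_inj/ffunP => b /=; apply: val_inj => /=.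
by rewrite (compatible_rank stdT cTt) -(compatible_rank (svalP U) cUt).
Qed.

End Standardization.

(** * The basis of standard polytabloids *)

Section Coordinates.

Variables (F : fieldType) (n m : nat) (rG : mx_representation F [set: 'S_n] m).
Variables (K : finType) (v : K -> 'rV[F]_m) (le : rel K).
Hypothesis basis_v : basis_of fullv (codom v).
Implicit Types (w : 'rV[F]_m) (t u : K).

Lemma nth_codom_rank t : (codom_tuple v)`_(enum_rank t) = v t.
Proof. by rewrite nth_codom enum_rankK. Qed.

Lemma sum_codom (c : K -> F) :
  \sum_(k < #|K|) c (enum_val k) *: (codom_tuple v)`_k = \sum_t c t *: v t.
Proof.
rewrite [RHS](reindex (@enum_val K predT)) /=; last exact/onW_bij/enum_val_bij.
by apply: eq_bigr => k _; rewrite nth_codom.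
Qed.

Lemma coord_at_basis t u : coord_at v (v t) u = (t == u)%:R.
Proof.
rewrite /coord_at -nth_codom_rank coord_free ?(inj_eq enum_rank_inj) //.
exact: basis_free basis_v.
Qed.

Lemma coord_atE w : w = \sum_t coord_at v w t *: v t.
Proof.
rewrite -sum_codom [LHS](@coord_span _ _ _ (codom_tuple v)).
  by apply: eq_bigr => k _; rewrite /coord_at enum_valK.
by rewrite (span_basis basis_v) memvf.
Qed.

Lemma eq_basis_mx (A B : 'M[F]_m) : (forall t, v t *m A = v t *m B) -> A = B.
Proof.
move=> eqAB; apply/row_matrixP => i; rewrite !rowE.
rewrite (coord_atE (delta_mx 0 i)) !mulmx_suml.
by apply: eq_bigr => t _; rewrite -!scalemxAl eqAB.
Qed.

Lemma basis_inj : injective v.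
Proof.
move=> t u /(congr1 (fun w => coord_at v w u)); rewrite !coord_at_basis eqxx.
by case: eqP => // _ /eqP; rewrite eq_sym oner_eq0.
Qed.

Lemma pibarE i t : v t *m pibar rG v le i = pibar_basis rG v le i t.
Proof.
(* [lin1_mx] records the values on unit vectors; linearity of the coordinates extends this to all
   [w]. *)
have lin1 (f : K -> 'rV[F]_m) w :
    w *m lin1_mx (fun w => \sum_t coord_at v w t *: f t)
    = \sum_t coord_at v w t *: f t.
  rewrite mulmx_sum_row.
  transitivity (\sum_j w 0 j *: \sum_t coord_at v (delta_mx 0 j) t *: f t).
    by apply: eq_bigr => j _; congr (_ *: _); apply/rowP => k; rewrite !mxE.
  under eq_bigr do rewrite scaler_sumr.
  rewrite exchange_big /=; apply: eq_bigr => u _.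
  rewrite [in RHS](row_sum_delta w) /coord_at linear_sum scaler_suml.
  by apply: eq_bigr => j _; rewrite scalerA linearZ.
rewrite /pibar lin1 (bigD1 t) //= big1 => [|u neut].
  by rewrite coord_at_basis eqxx scale1r addr0.
by rewrite coord_at_basis eq_sym (negPf neut) scale0r.
Qed.

Hypothesis le_anti : antisymmetric le.

Lemma trailing_termE w t : coord_at v w t != 0 ->
  (forall u, coord_at v w u != 0 -> le t u) ->
  trailing_term v le w = coord_at v w t *: v t.
Proof.
move=> wt0 min_t; rewrite /trailing_term; case: pickP => [u|none].
  move=> /andP[wu0 /forallP min_u].
  suff -> : u = t by [].
  by apply: le_anti; rewrite min_t // (implyP (min_u t)).
have := none t; rewrite /= wt0 /=; case/forallP => u.
by apply/implyP => /min_t.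
Qed.

Hypothesis le_refl : reflexive le.

Lemma trailing_termZ a t : a != 0 -> trailing_term v le (a *: v t) = a *: v t.
Proof.
move=> a0; have coordE u : coord_at v (a *: v t) u = a * (t == u)%:R.
  by rewrite {1}/coord_at linearZ /= -/(coord_at _ _ _) coord_at_basis.
rewrite (@trailing_termE _ t) => [||u]; rewrite coordE ?eqxx ?mulr1 //.
by have [<-|] := eqVneq t u; rewrite ?mulr0 ?eqxx.
Qed.

End Coordinates.

Section LeastElement.

Variables (K : finType) (le : rel K).
Hypotheses (le_refl : reflexive le) (le_trans : transitive le).
Hypothesis le_total : total le.

Lemma exists_least (P : pred K) (t0 : K) : P t0 ->
  exists2 t, P t & forall u, P u -> le t u.
Proof.
move=> Pt0; have [t Pt min_t] := extremumP id le_refl le_trans le_total Pt0.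
by exists t.
Qed.

End LeastElement.

(** * Standard polytabloids and the action of adjacent transpositions on them *)

Section SpechtBasis.

Variables (F : fieldType) (charF : [pchar F]%R =i pred0).
Variables (n : nat) (mu : seq nat).
Hypothesis mu_sorted : sorted geq mu.
Local Notation SYT := (SYT n mu).
Local Notation rows T := (fun x => rowof T x).
Local Notation le := (@syt_le n mu).
Local Notation U := (specht_space F n mu).
Local Notation v := (@standard_polytabloid F n mu).

Lemma syt_strictE (S T : SYT) : strict le S T = lexlt (rows (sval S)) (rows (sval T)).
Proof.
rewrite /strict /syt_le (syt_ltE mu_sorted); case: eqP => //= ->.
by rewrite lexlt_irr.
Qed.

Lemma polytabloid_specht T : (polytabloid F T <= U)%MS.
Proof. by rewrite (sumsmx_sup T) // genmxE. Qed.

Lemma val_standard_sum (c : SYT -> F) :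
  val_submod (\sum_t c t *: v t) = \sum_t c t *: polytabloid F (sval t).
Proof.
rewrite linear_sum; apply: eq_bigr => t _.
by rewrite linearZ /= in_submodK ?polytabloid_specht.
Qed.

(** Every other [t] that occurs exceeds [t1], and the least tabloid of its polytabloid is its own,
    so the tabloid of [t1] comes from [t1] alone. *)
Lemma standard_sum_coef (c : SYT -> F) (t1 : SYT) :
  (forall t, c t != 0 -> le t1 t) ->
  (\sum_t c t *: polytabloid F (sval t)) 0 (enum_rank (tabloid_of (sval t1))) = c t1.
Proof.
move=> min_t1; have cT (t : SYT) : col_inc (sval t : tableau n mu).
  by have [_] := standardP (sval t) (svalP t).
rewrite summxE (bigD1 t1) //= big1 => [|t net]; rewrite !mxE.
  by have [-> _] := polytabloid_trails F (cT t1); rewrite mulr1 addr0.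
have [->|/min_t1 lt] := eqVneq (c t) 0; first by rewrite mul0r.
apply/eqP; rewrite mulf_eq0; apply/orP; right; apply: contraT.
move/(polytabloid_trails F (cT t)).2; rewrite -syt_strictE /strict lt andbT.
by rewrite negbK eq_sym (negPf net).
Qed.

(** Turns a least tabloid into a trailing basis element: the least [t] that occurs has its tabloid
    in the sum, hence is not below [t0]. *)
Lemma standard_sum_trails (c : SYT -> F) (t0 : SYT) :
  trails (sval t0) (\sum_t c t *: polytabloid F (sval t)) ->
  c t0 = 1 /\ forall t, c t != 0 -> le t0 t.
Proof.
have [le_refl le_anti le_trans le_total] := @syt_le_order n mu mu_sorted.
move=> [w1 wlt]; have [t ct] : exists t, c t != 0.
  apply/existsP; apply: contraT => /existsPn c0; move: w1.
  rewrite big1 ?mxE => [/eqP|t _]; first by rewrite eq_sym oner_eq0.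
  by have := c0 t; rewrite negbK => /eqP ->; rewrite scale0r.
have [t1 ct1 min_t1] :=
  exists_least le_refl le_trans le_total (P := fun t => c t != 0) ct.
have := wlt (sval t1); rewrite standard_sum_coef // => /(_ ct1).
rewrite -syt_strictE /strict negb_and negbK => le01.
have {}le01 : le t0 t1.
  case/orP: le01 => [/eqP->//|]; have := le_total t0 t1.
  by case: (le t0 t1) => //= ->.
have min_t0 u : c u != 0 -> le t0 u by move/min_t1; apply: le_trans.
by rewrite -(standard_sum_coef min_t0).
Qed.

Lemma standard_polytabloid_basis : basis_of fullv (codom v).
Proof.
have [le_refl le_anti le_trans le_total] := @syt_le_order n mu mu_sorted.
apply/andP; split; last first.
  apply/(freeP (X := codom_tuple v)) => k k0.
  pose c t := k (enum_rank t).
  have {}k0 : \sum_t c t *: v t = 0.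
    by rewrite -sum_codom -[RHS]k0; apply: eq_bigr => i _; rewrite /c enum_valK.
  move=> i; apply/eqP; apply: contraT; rewrite -(enum_valK i) -/(c _) => ci.
  have [t1 ct1 min_t1] :=
    exists_least le_refl le_trans le_total (P := fun t => c t != 0) ci.
  by move: ct1; rewrite -(standard_sum_coef min_t1) -val_standard_sum k0 linear0 mxE
    eqxx.
rewrite eqEsubv subvf /=; apply/subvP => w _.
pose M := (\sum_(t : SYT) <<polytabloid F (sval t)>>)%MS.
have : (val_submod w <= M)%MS.
  apply: submx_trans (val_submodP w) _; apply/sumsmx_subP => T _; rewrite genmxE.
  apply: (standard_polytabloids_span charF mu_sorted) => V stdV.
  by rewrite (sumsmx_sup (exist _ V stdV : SYT)) // genmxE.
case/sub_sumsmxP => a eqw.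
have cE (t : SYT) : exists b,
    a t *m <<polytabloid F (sval t)>>%MS = b *: polytabloid F (sval t).
  by apply/sub_rVP; rewrite (submx_trans (submxMl _ _)) // genmxE.
have [c eqc] := fin_all_exists cE.
have -> : w = \sum_t c t *: v t.
  apply: val_submod_inj; rewrite val_standard_sum eqw.
  by apply: eq_bigr => t _; rewrite eqc.
apply: memv_suml => t _; apply/memvZ/memv_span; exact: codom_f.
Qed.

(** The default [t] keeps the map total; the true exchange is standard when the two letters share
    neither row nor column. *)
Definition swap_letters (i : 'I_n.-1) (t : SYT) : SYT :=
  insubd t (tact (adj i) (sval t)).

(** The single inversion of [adj i] is the pair of [lo i] and [hi i]. *)
Lemma adj_lt (i : 'I_n.-1) (x y : 'I_n) : (adj i x < adj i y)%N ->
  (x < y)%N \/ (adj i x = lo i /\ adj i y = hi i).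
Proof.
have adjE (z : 'I_n) : adj i z = (if z == i :> nat then i.+1
    else if z == i.+1 :> nat then i : nat else z) :> nat.
  case: eqP => [/= ez|/eqP ne1].
    by have -> : z = lo i; [apply: val_inj|rewrite adj_lo].
  case: eqP => [/= ez|/eqP ne2].
    by have -> : z = hi i; [apply: val_inj|rewrite adj_hi].
  by rewrite adj_fix.
move=> lt; have [ltxy|leyx] := ltnP x y; [by left | right].
suff [ex ey] : adj i x = i :> nat /\ adj i y = i.+1 :> nat.
  by split; apply: val_inj; rewrite /= ?ex ?ey.
by move: lt; rewrite !adjE; do ?case: ifP; lia.
Qed.

Lemma tact_adj_standard (T : tableau n mu) (i : 'I_n.-1) : is_standard T ->
  rowof T (lo i) <> rowof T (hi i) -> colof T (lo i) <> colof T (hi i) ->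
  is_standard (tact (adj i) T).
Proof.
move=> /standardP[rT cT] ner nec; apply/standardP; split=> x y;
  rewrite !pos_adj => e lt.
  by case: (adj_lt (rT _ _ e lt)) => // -[ex ey]; rewrite ex ey in e.
by case: (adj_lt (cT _ _ e lt)) => // -[ex ey]; rewrite ex ey in e.
Qed.

Lemma val_swap_letters (i : 'I_n.-1) (t : SYT) :
  rowof (sval t) (lo i) <> rowof (sval t) (hi i) ->
  colof (sval t) (lo i) <> colof (sval t) (hi i) ->
  sval (swap_letters i t) = tact (adj i) (sval t).
Proof.
by move=> ner nec; rewrite [LHS]insubdK //; apply: tact_adj_standard (svalP t) _ _.
Qed.

Lemma south_colof (i : 'I_n.-1) (t : SYT) :
  (rowof (sval t) (hi i) < rowof (sval t) (lo i))%N ->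
  colof (sval t) (lo i) <> colof (sval t) (hi i).
Proof.
have [_ cT] := standardP (sval t) (svalP t).
by move=> lt ec; have := cT _ _ (esym ec) lt; rewrite /=; lia.
Qed.

Lemma rowof_swap_letters (i : 'I_n.-1) (t : SYT) x :
  (rowof (sval t) (hi i) < rowof (sval t) (lo i))%N ->
  rowof (sval (swap_letters i t)) x = rowof (sval t) (adj i x).
Proof.
move=> lt; rewrite val_swap_letters ?pos_adj //; last exact: south_colof.
by move=> e; rewrite e ltnn in lt.
Qed.

Lemma swap_letters_lt (i : 'I_n.-1) (t : SYT) :
  (rowof (sval t) (hi i) < rowof (sval t) (lo i))%N ->
  strict le (swap_letters i t) t.
Proof.
move=> lt; rewrite syt_strictE; apply/lexltP; exists (lo i) => [y /= ltyi|].
  by rewrite rowof_swap_letters // adj_fix //; lia.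
by rewrite rowof_swap_letters // adj_lo.
Qed.

Lemma sact_standard (i : 'I_n.-1) (t : SYT) :
  sact (specht F n mu) i (v t) = in_submod U (polytabloid F (tact (adj i) (sval t))).
Proof.
rewrite /sact /= -polytabloidJ /standard_polytabloid.
exact/esym/(in_submodJ (specht_module F n mu))/polytabloid_specht.
Qed.

Lemma sact_swap (i : 'I_n.-1) (t : SYT) :
  rowof (sval t) (lo i) <> rowof (sval t) (hi i) ->
  colof (sval t) (lo i) <> colof (sval t) (hi i) ->
  sact (specht F n mu) i (v t) = v (swap_letters i t).
Proof. by move=> ner nec; rewrite sact_standard -val_swap_letters. Qed.

Lemma sact_column (i : 'I_n.-1) (t : SYT) :
  colof (sval t) (lo i) = colof (sval t) (hi i) ->
  sact (specht F n mu) i (v t) = - v t.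
Proof.
move=> eqc; rewrite sact_standard polytabloid_col_stab; last first.
  by apply/forallP => x; rewrite /adj; case: tpermP => // ->; rewrite eqc.
rewrite /adj odd_tperm -val_eqE /= neq_ltn ltnSn expr1 scaleN1r.
by rewrite linearN.
Qed.

Lemma trailing_term_row (i : 'I_n.-1) (t : SYT) :
  rowof (sval t) (lo i) = rowof (sval t) (hi i) ->
  trailing_term v le (sact (specht F n mu) i (v t)) = v t.
Proof.
have [le_refl le_anti le_trans le_total] := @syt_le_order n mu mu_sorted.
have bas := standard_polytabloid_basis.
move=> eqr; set w := sact _ _ _.
have [_ cT] := standardP (sval t) (svalP t).
have := @polytabloid_adj_trails F _ _ (sval t) i cT eqr.
have -> : polytabloid F (tact (adj i) (sval t)) = val_submod w.
  by rewrite /w sact_standard in_submodK // polytabloid_specht.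
rewrite (coord_atE bas w) val_standard_sum => /standard_sum_trails[w1 wlt].
by rewrite -(coord_atE bas) (@trailing_termE _ _ _ _ _ _ _ t) // w1 ?scale1r ?oner_eq0.
Qed.

(** Translates the ordered case distinction of [pibar] into a comparison of two rows. Excluding the
    earlier cases needs that the basis vectors are distinct and none is the negative of another. *)
Lemma pibar_basis_cases (i : 'I_n.-1) (t : SYT) :
  [|| case_zero (specht F n mu) v le i t, case_opp (specht F n mu) v le i t
    | case_swap (specht F n mu) v le i t]
  /\ pibar_basis (specht F n mu) v le i t =
     if rowof (sval t) (lo i) == rowof (sval t) (hi i) then 0
     else if (rowof (sval t) (lo i) < rowof (sval t) (hi i))%N then - v t
     else v (swap_letters i t).
Proof.
have [le_refl le_anti le_trans le_total] := @syt_le_order n mu mu_sorted.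
have bas := standard_polytabloid_basis; have v_inj := basis_inj bas.
have anti s u : strict le s u -> strict le u s -> False.
  by rewrite !syt_strictE; apply: lexlt_asym.
have vN s u : v s <> - v u.
  move=> /(congr1 (fun w => coord_at v w s)); rewrite (coord_at_basis bas) eqxx.
  rewrite /coord_at linearN /= -/(coord_at _ _ _) (coord_at_basis bas).
  case: eqP => _ /eqP; last by rewrite oppr0 oner_eq0.
  rewrite -addr_eq0 -[1 + 1]/(2%:R).
  by have /pcharf0P -> := charF.
have ttv u : trailing_term v le (v u) = v u.
  by rewrite -[v u]scale1r trailing_termZ // oner_eq0.
have ttvN u : trailing_term v le (- v u) = - v u.
  by rewrite -scaleN1r trailing_termZ // oppr_eq0 oner_eq0.
rewrite /pibar_basis; case: ltngtP => [north|south|same]; last first.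
- have -> : case_zero (specht F n mu) v le i t by apply/eqP/trailing_term_row.
  by [].
- have ner : rowof (sval t) (lo i) <> rowof (sval t) (hi i) by lia.
  have := sact_swap ner (south_colof south); have slt := swap_letters_lt south.
  rewrite /case_zero /case_opp /case_swap => ->; rewrite ttv.
  have net : swap_letters i t != t by case/andP: slt.
  rewrite (inj_eq v_inj) (negPf net) /=.
  have -> /= : (v (swap_letters i t) == - v t) = false by apply/eqP/vN.
  rewrite orbF; case: existsP => [[u /andP[ltu /eqP/v_inj eu]]|_].
    by case: (anti _ _ ltu); rewrite -eu.
  by split=> //; apply/existsP; exists (swap_letters i t); rewrite slt eqxx.
have ner : rowof (sval t) (lo i) <> rowof (sval t) (hi i) by lia.
(* Both ways of having [hi i] north of [lo i] give [- v t]: in one column [s_i] acts by -1,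
   otherwise it yields a larger basis element. *)
have [eqc|nec] := eqVneq (colof (sval t) (lo i)) (colof (sval t) (hi i)).
  have := sact_column eqc; rewrite /case_zero /case_opp => ->; rewrite ttvN.
  by rewrite eqxx !orbT /= eq_sym; case: eqP => // /vN.
have := sact_swap ner (elimN eqP nec).
have slt : strict le t (swap_letters i t).
  rewrite syt_strictE; apply/lexltP; exists (lo i) => [y /= ltyi|].
    by rewrite val_swap_letters ?pos_adj ?adj_fix //; [lia|lia|exact/eqP].
  by rewrite val_swap_letters ?pos_adj ?adj_lo //; exact/eqP.
rewrite /case_zero /case_opp => ->; rewrite ttv (inj_eq v_inj) eq_sym.
case/andP: (slt) => /negPf -> _ /=.
have -> /= : [exists u, strict le t u && (v (swap_letters i t) == v u)].
  by apply/existsP; exists (swap_letters i t); rewrite slt eqxx.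
by [].
Qed.

End SpechtBasis.

(** * The 0-Hecke module *)

Section RowWordModule.

Variables (F : fieldType) (n m : nat) (K : finType) (v : K -> 'rV[F]_m).
Variables (le : rel K) (pi : 'I_n.-1 -> 'M[F]_m).
Variables (R : K -> 'I_n -> nat) (s : 'I_n.-1 -> K -> K).
Hypothesis basis_v : basis_of fullv (codom v).
Hypotheses (le_anti : antisymmetric le) (le_trans : transitive le).
Hypothesis le_total : total le.
Hypothesis R_inj : forall t u, R t =1 R u -> t = u.
Hypothesis pi_eq : forall i t, R t (lo i) = R t (hi i) -> v t *m pi i = 0.
Hypothesis pi_lt : forall i t,
  (R t (lo i) < R t (hi i))%N -> v t *m pi i = - v t.
Hypothesis pi_gt : forall i t,
  (R t (hi i) < R t (lo i))%N -> v t *m pi i = v (s i t).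
Hypothesis R_s : forall i t x,
  (R t (hi i) < R t (lo i))%N -> R (s i t) x = R t (adj i x).
Hypothesis s_strict : forall i t,
  (R t (hi i) < R t (lo i))%N -> strict le (s i t) t.

Lemma adj_disjoint (i j : 'I_n.-1) : (i + 2 <= j)%N || (j + 2 <= i)%N ->
  [/\ adj i (lo j) = lo j, adj i (hi j) = hi j
    & forall x, adj i (adj j x) = adj j (adj i x)].
Proof.
move=> dij; have fl : adj i (lo j) = lo j by apply: adj_fix => /=; lia.
have fh : adj i (hi j) = hi j by apply: adj_fix => /=; lia.
split=> // x; rewrite -!permM; congr (fun_of_perm _ x).
apply: (mulgI (adj i)^-1%g); rewrite mulKg -conjgE.
by rewrite {3}/adj tpermJ fl fh.
Qed.

(** Both sides are conjugates of an adjacent transposition and equal the transposition of [lo i] and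
    [hi j]. *)
Lemma adj_braid (i j : 'I_n.-1) x : j = i.+1 :> nat ->
  adj i (adj j (adj i x)) = adj j (adj i (adj j x)).
Proof.
move=> ej; have eb : lo j = hi i by apply: val_inj.
have fa : adj j (lo i) = lo i by apply: adj_fix => /=; lia.
have fc : adj i (hi j) = hi j by apply: adj_fix => /=; lia.
rewrite -!permM; congr (fun_of_perm _ x).
have conjE (k l : 'I_n.-1) : (adj k * (adj l * adj k) = adj l ^ adj k)%g.
  by rewrite conjgE adjV.
rewrite !conjE {1}/adj tpermJ eb adj_hi fc.
by rewrite [in RHS]/adj tpermJ fa -/(adj _) -eb adj_lo.
Qed.

(** Recursive because the side condition of [R_s] is itself a comparison in a word that may already
    have been exchanged. *)
Ltac rows vals :=
  repeat (rewrite R_s; [|by rows vals]); rewrite ?vals; lia.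

Ltac act vals := repeat first
  [ rewrite mulNmx | rewrite mul0mx | rewrite oppr0 | rewrite opprK
  | rewrite pi_eq; [|by rows vals] | rewrite pi_lt; [|by rows vals]
  | rewrite pi_gt; [|by rows vals]].

Lemma row_word_hecke0 : hecke0_rels pi.
Proof.
split=> [i|i j dij|i j eij]; apply: (eq_basis_mx basis_v) => t.
- pose vals := (@adj_lo n i, @adj_hi n i).
  rewrite mulmxN !mulmxA.
  by case: (ltngtP (R t (lo i)) (R t (hi i))) => ?; act vals.
- have [f1 f2 fij] := adj_disjoint dij.
  have dji : (j + 2 <= i)%N || (i + 2 <= j)%N by rewrite orbC.
  have [f3 f4 _] := adj_disjoint dji.
  pose vals := (f1, f2, f3, f4).
  rewrite !mulmxA.
  case: (ltngtP (R t (lo i)) (R t (hi i))) => ?;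
  case: (ltngtP (R t (lo j)) (R t (hi j))) => ?; act vals => //.
  (* What remains is the case where both generators exchange letters. *)
  congr (v _); apply: R_inj => x.
  do 4![rewrite R_s; last by rows vals].
  by rewrite fij.
have eb : lo j = hi i by apply: val_inj.
have fa : adj j (lo i) = lo i by apply: adj_fix => /=; lia.
have fc : adj i (hi j) = hi j by apply: adj_fix => /=; lia.
have fb : adj j (hi i) = hi j by rewrite -eb adj_lo.
have fd : adj j (hi j) = hi i by rewrite adj_hi eb.
pose vals := (eb, fa, fc, fb, fd, @adj_lo n i, @adj_hi n i).
rewrite !mulmxA.
case: (ltngtP (R t (lo i)) (R t (hi i))) => ?;
case: (ltngtP (R t (hi i)) (R t (hi j))) => ?;
case: (ltngtP (R t (lo i)) (R t (hi j))) => ?; try lia; act vals => //.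
(* What remains is the strictly decreasing case, where both sides perform three exchanges. *)
congr (v _); apply: R_inj => x.
do 6![rewrite R_s; last by rows vals].
by rewrite adj_braid.
Qed.

Definition word_descents (t : K) : {set 'I_n.-1} :=
  [set i | (R t (lo i) < R t (hi i))%N].

Lemma row_word_composition :
  composition_factors pi [seq word_descents t | t <- sort le (enum K)].
Proof.
set ord := sort le (enum K); set Is := map _ _.
have ord_uniq : uniq ord by rewrite sort_uniq enum_uniq.
have ord_all t : t \in ord by rewrite mem_sort mem_enum.
pose idx t := index t ord.
have idx_lt t : (idx t < size ord)%N by rewrite index_mem.
have idx_strict t u : strict le u t -> (idx u < idx t)%N.
  move=> /andP[neut leut]; rewrite ltnNge leq_eqVlt; apply/negP => /orP[/eqP e|lt].
    by case/eqP: neut; rewrite -(nth_index u (ord_all u)) -/(idx u) -e nth_index.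
  have letu : le t u.
    have ord_sorted := sort_sorted le_total (enum K).
    exact: (sorted_ltn_index le_trans ord_sorted _ _ (ord_all t) (ord_all u) lt).
  by case/eqP: neut; apply: le_anti; rewrite leut.
pose U j : 'M[F]_m := (\sum_(t | (idx t < j)%N) <<v t>>)%MS.
have vU t j : (idx t < j)%N -> (v t <= U j)%MS.
  by move=> lt; rewrite (sumsmx_sup t) // genmxE.
have coordU j (u : 'rV[F]_m) t : (u <= U j)%MS -> (j <= idx t)%N -> coord_at v u t = 0.
  case/sub_sumsmxP => a -> lejt; rewrite /coord_at linear_sum big1 // => t' ltj.
  have /sub_rVP[b ->] : (a t' *m <<v t'>> <= v t')%MS.
    by rewrite (submx_trans (submxMl _ _)) // genmxE.
  rewrite linearZ /= -/(coord_at _ _ _) (coord_at_basis basis_v).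
  by case: eqP => [e|]; rewrite ?mulr0 //; rewrite e in ltj; lia.
(* Triangularity: up to earlier basis vectors, [pi i] acts on [v t] by the scalar of its descent
   set. *)
have actU t i : exists2 u, (u <= U (idx t))%MS
    & v t *m pi i = simple_scalar F (word_descents t) i *: v t + u.
  rewrite /simple_scalar inE; case: ltngtP => [lt|gt|e].
  - by exists 0; rewrite ?sub0mx // pi_lt // scaleN1r addr0.
  - exists (v (s i t)); last by rewrite pi_gt // scale0r add0r.
    exact/vU/idx_strict/s_strict.
  - by exists 0; rewrite ?sub0mx // pi_eq // scale0r add0r.
have UU j k : (j <= k)%N -> (U j <= U k)%MS.
  move=> lejk; apply/sumsmx_subP => t lt; rewrite genmxE; apply: vU.
  exact: leq_trans lejk.
exists U; rewrite size_map; split.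
- by rewrite /U big1.
- apply/eqmxP; rewrite submx1 /=; apply/row_subP => k.
  rewrite (coord_atE basis_v (row k _)) summx_sub // => t _.
  by rewrite scalemx_sub // vU.
- move=> j i _; rewrite /U sumsmxMr; apply/sumsmx_subP => t lt.
  rewrite (eqmxMr _ (genmxE _)); have [u uU ->] := actU t i.
  by rewrite addmx_sub ?scalemx_sub ?vU // (submx_trans uU) // UU // ltnW.
move=> j ltj; have [t0 _] : exists t0 : K, true.
  by move: ltj; case: (ord) => [//|t0 l] _; exists t0.
pose t := nth t0 ord j; have idx_t : idx t = j by rewrite /idx index_uniq.
have idx_eq u : idx u = j -> u = t by move=> e; rewrite /t -e nth_index.
have nthI : nth set0 Is j = word_descents t by rewrite /Is (nth_map t0).
split; first exact: UU.
  have vNU : ~~ (v t <= U j)%MS.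
    apply/negP => /coordU/(_ (eq_leq (esym idx_t))).
    by rewrite (coord_at_basis basis_v) eqxx => /eqP; rewrite oner_eq0.
  have eU : (U j.+1 :=: U j + <<v t>>)%MS.
    apply/eqmxP; apply/andP; split; last first.
      by rewrite addsmx_sub UU // genmxE vU // idx_t.
    apply/sumsmx_subP => u; rewrite genmxE ltnS leq_eqVlt => /orP[/eqP/idx_eq->|lt].
      by apply: submx_trans (addsmxSr _ _); rewrite genmxE.
    by apply: submx_trans (addsmxSl _ _); apply: vU.
  (* Adding one vector raises the rank by at most 1, and it does raise it since [v t] is not in
     [U j]. *)
  apply/eqP; rewrite eqn_leq; apply/andP; split.
    rewrite eU -[X in (_ <= X)%N]addn1.
    apply: leq_trans (mxrank_adds_leqif _ _).1 _.
    by rewrite leq_add2l genmxE rank_leq_row.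
  apply: rank_ltmx; rewrite ltmxE UU //=; apply: contra vNU => le1.
  by apply: submx_trans le1; rewrite vU // idx_t.
move=> i u uU; rewrite nthI.
rewrite (coord_atE basis_v u) mulmx_suml scaler_sumr -sumrB summx_sub // => x _.
rewrite -scalemxAl scalerA mulrC -scalerA -scalerBr.
(* Earlier vectors lie in the stable space [U j], later ones have coordinate 0 in [u], and the
   vector at index [j] is handled by triangularity. *)
have [lt|gt|e] := ltngtP (idx x) j.
- rewrite scalemx_sub // addmx_sub ?eqmx_opp ?scalemx_sub ?vU //.
  have [w wU ->] := actU x i.
  by rewrite addmx_sub ?scalemx_sub ?vU // (submx_trans wU) // UU // ltnW.
- by rewrite (coordU _ _ _ uU) ?scale0r ?sub0mx.
rewrite (idx_eq x e); have [w wU ->] := actU t i.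
by rewrite addrC addKr scalemx_sub // -idx_t.
Qed.

End RowWordModule.

(** A one-term iterated direct sum ends in a zero representation, which has to be split off. *)
Lemma mx_rsim_dadd0 (F : fieldType) (gT : finGroupType) (G : {group gT})
  (rG : representation F G) : mx_rsim rG (dadd_grepr rG grepr0).
Proof.
exists (row_mx 1%:M 0); first by rewrite /= addn0.
  by apply/row_freeP; exists (col_mx 1%:M 0); rewrite mul_row_col mulmx1 mul0mx addr0.
move=> x Gx /=.
by rewrite mul_row_block mul_mx_row !mul1mx !mulmx1 !mulmx0 ?mul0mx !addr0.
Qed.

Theorem theorem4 (F : fieldType) (charF : [pchar F]%R =i pred0)
    (n : nat) (la : intpart n) :
  SQCC (specht F n la) (@standard_polytabloid F n la) (@syt_le n la).
Proof.
have la_sorted : sorted geq la by case/and3P: (intpartP la).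
have [le_refl le_anti le_trans le_total] := @syt_le_order n la la_sorted.
have bas := @standard_polytabloid_basis F charF n la la_sorted.
have cases := @pibar_basis_cases F charF n la la_sorted.
pose R (t : SYT n la) x := rowof (sval t) x.
set p := pibar (specht F n la) (@standard_polytabloid F n la) (@syt_le n la).
have pE i (t : SYT n la) : standard_polytabloid F t *m p i
    = if R t (lo i) == R t (hi i) then 0
      else if (R t (lo i) < R t (hi i))%N then - standard_polytabloid F t
      else standard_polytabloid F (swap_letters i t).
  by rewrite -(cases i t).2 /p (pibarE _ _ bas).
have R_inj t u : R t =1 R u -> t = u.
  by move=> eqR; apply/val_inj/(standard_rows_inj la_sorted (svalP t) (svalP u)).
have p_eq i t : R t (lo i) = R t (hi i) -> standard_polytabloid F t *m p i = 0.
  by rewrite pE => ->; rewrite eqxx.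
have p_lt i t : (R t (lo i) < R t (hi i))%N ->
    standard_polytabloid F t *m p i = - standard_polytabloid F t.
  by rewrite pE; case: ltngtP.
have p_gt i t : (R t (hi i) < R t (lo i))%N ->
    standard_polytabloid F t *m p i = standard_polytabloid F (swap_letters i t).
  by rewrite pE; case: ltngtP.
have R_s i t x (lt : (R t (hi i) < R t (lo i))%N) := rowof_swap_letters la_sorted x lt.
have s_strict i t (lt : (R t (hi i) < R t (lo i))%N) := swap_letters_lt la_sorted lt.
split; [exact: bas | by split | by move=> i t; have [] := cases i t | |].
  exact: (row_word_hecke0 bas R_inj p_eq p_lt p_gt R_s).
exists (schur la); split.
  exists [:: la]; split=> [|N]; last by rewrite big_seq1.
  by rewrite big_cons big_nil; apply: mx_rsim_dadd0.
exists [seq word_descents R t | t <- sort (@syt_le n la) (enum (SYT n la : finType))].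
split.
  exact: (row_word_composition bas le_anti le_trans le_total p_eq p_lt p_gt
    s_strict).
(* Sorting does not affect the sum, and [word_descents R t] unfolds to the descent set of [t]. *)
move=> N; rewrite big_map (perm_big (enum (SYT n la : finType))) /=; last first.
  by rewrite perm_sort.
by rewrite (schur_fundamental (intpartP la)) big_enum.
Qed.
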